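(* Let $\gamma\ge 0$ and consider the many-to-many communication task described in the context. For each $n$ let $C_n>0$ satisfy $$\frac{C_n}{n^\gamma}<\frac12\ \text{ for all sufficiently large } n,\qquad a\,n\Big(\frac{C_n}{n^\gamma}\Big)^2+\ln\frac{C_n}{n^\gamma}\to\infty,$$ where $a=\frac{1}{2^{13}\pi}\ln\frac{e}{2}$. Then for any $n$, any $D_n>0$ and any source-destination set $\mathcal{P}_n$ there exists a system $\mathcal{S}_n(\mathcal{P}_n)$ with throughput $\lambda_n(\mathcal{P}_n)$ such that for any packet size $W>0$, as $n\to\infty$, $$\Pr\big(\mathcal{S}_n(\mathcal{P}_n)\text{ is DC}(C_n,D_n)\text{-successful}\big)\to 1$$ and $$\Pr\Big(\lambda_n(\mathcal{P}_n)\ge\frac{W}{c\,n^{1-\gamma}C_n(2+D_n)^2}\Big)\to1,$$ where $c=27\times 2^{14}$ and probabilities are over the random source-destination set.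
   Context: Network model: $A_n\subset\mathbb{R}^2$ is a disk of radius $n^\gamma$. Nodes $s_1,\dots,s_n$ are drawn i.i.d. uniformly on $A_n$; for each $i$, a destination $d_i$ is chosen uniformly from $\{s_j:j\ne i\}$, independently of everything else. $\mathcal{P}_n=\{(s_1,d_1),\dots,(s_n,d_n)\}$. Time is slotted; each node transmits at most one packet of $W$ bits per slot. A route for $(s_i,d_i)$ is a sequence of hops $(t_{i,j},r_{i,j})$, $j=1,\dots,J_i$, of nodes with $t_{i,1}=s_i$, $r_{i,j}=t_{i,j+1}$, $r_{i,J_i}=d_i$, no node repeated. A schedule assigns each hop a positive integer slot $\sigma_{i,j}$. A system is a set of $n$ scheduled routes, one per pair, which is compatible: no node is required to transmit two hops in the same slot. Its period is $p=\max_{i,j}\sigma_{i,j}$, and its throughput is $\lambda=W/p$. For each slot $j$, $\mathcal{H}_j$ is the set of hops scheduled in slot $j$ and $T_j$ the set of their transmitters. A system is successful under a criterion if for every slot $j$ and every hop $(t,r)\in\mathcal{H}_j$, the criterion holds for $(t,r,T_j\setminus\{t\})$. Distance-based criterion DC$(C,D)$ ($C,D>0$): $(t,r,T)$, with $t,r\in\mathbb{R}^2$ and $T$ a finite subset of $\mathbb{R}^2$, satisfies DC$(C,D)$ if $\|t-r\|\le C$ and $\|t'-t''\|\ge C(2+D)$ for all distinct $t',t''\in T\cup\{t\}$. *)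

(* Defs.v *)
From HB Require Import structures.
From mathcomp Require Import all_boot all_order all_algebra.
From mathcomp Require Import all_classical all_reals all_analysis.
Set Implicit Arguments. Unset Strict Implicit. Unset Printing Implicit Defensive.
Import Order.TTheory GRing.Theory Num.Theory.
Import numFieldNormedType.Exports.
Local Open Scope classical_set_scope.
Local Open Scope ring_scope.

Section Network.
Variable R : realType.

Definition pt2 := (R * R)%type.
Definition dist (p q : pt2) : R :=
  Num.sqrt ((p.1 - q.1) ^+ 2 + (p.2 - q.2) ^+ 2).

Definition disk (rad : R) : set pt2 := [set p | dist p (0, 0) <= rad].

Definition leb2 : set pt2 -> \bar R :=
  ((@lebesgue_measure R) \x (@lebesgue_measure R))%E.

Definition unif_disk (rad : R) (A : set pt2) : R :=
  fine (leb2 (A `&` disk rad)) / (pi * rad ^+ 2).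

Definition DC (C D : R) (t r : pt2) (T : set pt2) : Prop :=
  dist t r <= C /\
  forall u v, (T u \/ u = t) -> (T v \/ v = t) -> u <> v -> C * (2 + D) <= dist u v.

(* A scheduled hop: ((transmitter, receiver), slot); nodes are indices in 'I_n. *)
Definition shop (n : nat) := ('I_n * 'I_n * nat)%type.

(* A valid scheduled route for the pair (s_i, d_i) where d_i = s_(dest i):
   nonempty, t_1 = i, r_j = t_(j+1), r_J = dest i, no node repeated,
   positive slots. *)
Definition sched_route n (dest : 'I_n -> 'I_n) (i : 'I_n) (rt : seq (shop n)) : Prop :=
  rt <> [::] /\
  [seq x.1.1 | x <- rt] ++ [:: dest i] = i :: [seq x.1.2 | x <- rt] /\
  uniq (i :: [seq x.1.2 | x <- rt]) /\
  all (fun x => 0 < x.2)%N rt.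

Definition all_hops n (sys : 'I_n -> seq (shop n)) : seq (shop n) :=
  flatten [seq sys i | i <- enum 'I_n].

Definition compatible n (sys : 'I_n -> seq (shop n)) : Prop :=
  uniq [seq (x.1.1, x.2) | x <- all_hops sys].

Definition is_system n (dest : 'I_n -> 'I_n) (sys : 'I_n -> seq (shop n)) : Prop :=
  (forall i, sched_route dest i (sys i)) /\ compatible sys.

Definition period n (sys : 'I_n -> seq (shop n)) : nat :=
  foldr maxn 0%N [seq x.2 | x <- all_hops sys].
Definition throughput n (W : R) (sys : 'I_n -> seq (shop n)) : R :=
  W / (period sys)%:R.

Definition DC_successful n (C D : R) (pos : 'I_n -> pt2)
    (sys : 'I_n -> seq (shop n)) : Prop :=
  forall x, x \in all_hops sys ->
    DC C D (pos x.1.1) (pos x.1.2)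
      (fun y => y <> pos x.1.1 /\
         exists2 z, z \in all_hops sys & z.2 = x.2 /\ pos z.1.1 = y).

(* The random source-destination set P_n on a probability space (Omega, P):
   pos i = s_i, dst i = index of d_i; s_1..s_n i.i.d. uniform on the disk of
   radius rad, d_i uniform on the other nodes, all independent.  Stated as the
   joint law on measurable rectangles. *)
Definition random_SD_set (dO : measure_display) (Omega : measurableType dO)
    (P : probability Omega R) (n : nat) (rad : R)
    (pos : 'I_n -> Omega -> pt2) (dst : 'I_n -> Omega -> 'I_n) : Prop :=
  (forall i, measurable_fun setT (pos i)) /\
  (forall i k, measurable (dst i @^-1` [set k])) /\
  forall (A : 'I_n -> set pt2) (k : 'I_n -> 'I_n),
    (forall i, measurable (A i)) ->
    P (\bigcap_i (pos i @^-1` A i `&` dst i @^-1` [set k i])) =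
    (\prod_(i < n) (unif_disk rad (A i) *
                    (if k i != i then (n.-1)%:R^-1 else 0)))%:E.

Definition const_a : R := (2 ^+ 13 * pi)^-1 * ln (expR 1 / 2).
Definition const_c : R := 27 * 2 ^+ 14.

End Network.

(* Main.v *)
Require Import Defs.
From HB Require Import structures.
From mathcomp Require Import all_boot all_order all_algebra.
From mathcomp Require Import all_classical all_reals all_analysis measurable_realfun.
From mathcomp Require Import ring lra zify.
Import Order.TTheory GRing.Theory Num.Theory.
Import numFieldNormedType.Exports.
Set Implicit Arguments. Unset Strict Implicit. Unset Printing Implicit Defensive.
Local Open Scope classical_set_scope.
Local Open Scope ring_scope.

(** Cut the plane into square cells of side [l = C/8] and contract it towards the
    origin by [s = 1 - 2l/rad], so that the cell of every contracted node lies in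
    the disk.  A packet travels through an L-shaped sequence of such cells, and
    each cell lends one of the nodes it contains as a relay.  Nodes in cells whose
    coordinates agree modulo [K ~ 8(2+D)] are far enough apart to transmit
    simultaneously, hence a period of [K^2] times the largest load of a cell.  A
    route uses a cell only if its source or its destination lies in the row or in
    the column of the cell, so the load is bounded by the numbers of sources and
    of destinations in vertical and horizontal slabs, each of probability at most
    [rho = C/rad].  By a Chernoff bound these numbers are [O(n rho)] outside an
    event of probability [O(exp (- n rho))], and a cell is empty with probability
    at most [exp (- n rho^2 / (64 pi))]; the hypothesis on [C] makes the union bound
    over the [O(1/rho)] slabs and the [O(1/rho^2)] cells tend to [0]. *)

(** * Finite product measures *)

Lemma expR_half_le2 (R : realType) : expR (2^-1) <= 2 :> R.
Proof.
have h : 2^-1 <= expR (- 2^-1) :> R.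
  by apply: le_trans (expR_ge1Dx (- 2^-1)); lra.
by rewrite -(invrK (expR _)) -expRN -[leRHS]invrK lef_pV2 ?posrE ?expR_gt0.
Qed.

(** Chernoff's method with base 2 for the number [N] of indices [i] with [S i (f i)], the
    coordinates of [f] being independent. The mean of [2 ^ N] is at most [expR m], while [N > t]
    forces [2 ^ N >= expR (t / 2)]. The quotient [expR (m - t / 2)] is at most [expR (- m)] because
    [t >= 4 * m]. *)
Lemma prod_weight_chernoff (R : realType) (n : nat) (T : finType)
    (w : 'I_n -> T -> R) (S : 'I_n -> pred T) (m t : R) :
  (forall i x, 0 <= w i x) -> (forall i, \sum_x w i x = 1) ->
  \sum_i \sum_(x | S i x) w i x <= m -> 4 * m <= t ->
  \sum_(f : {ffun 'I_n -> T} | t < #|[pred i | S i (f i)]|%:R)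
     \prod_i w i (f i) <= expR (- m).
Proof.
move=> w0 w1 Sm mt.
pose v i x : R := if S i x then 2 else 1.
have v0 i x : 0 <= v i x by rewrite /v; case: ifP.
(* Markov's inequality, term by term: the product of the [v i (f i)] is [2 ^ N]. *)
have bound (f : {ffun 'I_n -> T}) : t < #|[pred i | S i (f i)]|%:R ->
    \prod_i w i (f i) <= expR (- (t / 2)) * \prod_i (w i (f i) * v i (f i)).
  move=> tf; rewrite big_split /= mulrCA ler_peMr ?prodr_ge0 //.
  rewrite -big_mkcond /= prodr_const.
  set k := #|_|; have tk : t < k%:R by [].
  rewrite expRN -ler_pdivrMl ?invr_gt0 ?expR_gt0 // invrK mulr1.
  apply: (@le_trans _ _ (expR (2^-1) ^+ k)).
    by rewrite -expRM_natl ler_expR; lra.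
  by rewrite lerXn2r ?nnegrE ?expR_ge0 // expR_half_le2.
apply: le_trans (ler_sum _ bound) _.
rewrite -mulr_sumr.
(* Extending the sum to all [f] lets it factor over the coordinates. *)
apply: (@le_trans _ _ (expR (- (t / 2)) * \prod_i (\sum_x w i x * v i x))).
  rewrite ler_wpM2l ?expR_ge0 // bigA_distr_bigA /=.
  rewrite [leRHS](bigID (fun f : {ffun 'I_n -> T} =>
     t < #|[pred i | S i (f i)]|%:R)) /= lerDl sumr_ge0 // => f _.
  by apply: prodr_ge0 => i _; apply: mulr_ge0.
have fact i : \sum_x w i x * v i x <= expR (\sum_(x | S i x) w i x).
  apply: le_trans (expR_ge1Dx _).
  rewrite -(w1 i) [X in _ + X]big_mkcond -big_split /= ler_sum // => x _.
  by rewrite /v; case: ifP => _; lra.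
apply: (@le_trans _ _ (expR (- (t / 2)) * expR m)).
  rewrite ler_wpM2l ?expR_ge0 //.
  apply: (@le_trans _ _ (\prod_i expR (\sum_(x | S i x) w i x))).
    apply: ler_prod => i _; rewrite fact andbT.
    by apply: sumr_ge0 => x _; apply: mulr_ge0.
  by rewrite -expR_sum ler_expR.
by rewrite -expRD ler_expR; lra.
Qed.

(** * The law of the source-destination set *)

Lemma finite_valued_law (d : measure_display) (Omega : measurableType d)
    (R : realType) (P : probability Omega R) (T : finType) (g : Omega -> T)
    (E : pred T) :
  (forall t, measurable (g @^-1` [set t])) ->
  measurable [set w | E (g w)] /\
  P [set w | E (g w)] = (\sum_(t | E t) P (g @^-1` [set t]))%E.
Proof.
move=> mg.
have -> : [set w | E (g w)] = \bigcup_(t in [set` E]) (g @^-1` [set t]).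
  by apply/seteqP; split=> [w Ew|w [t Et /= ->]//]; exists (g w).
have fE : finite_set [set` E] by exact: finite_finset.
split; first by apply: fin_bigcup_measurable.
rewrite measure_fin_bigcup //; last first.
  by apply/trivIsetP => s t _ _ st; apply/seteqP; split=> w //= [-> tw];
     move: st; rewrite tw eqxx.
by rewrite (bigfs _ (r := index_enum T)) // ?index_enum_uniq // => t _; rewrite mem_index_enum.
Qed.

Lemma measure_bigsetU_le (d : measure_display) (T : measurableType d)
    (R : realType) (mu : {measure set T -> \bar R}) (I : finType) (F : I -> set T) :
  (forall i, measurable (F i)) ->
  (mu (\bigcup_i F i) <= \sum_i mu (F i))%E.
Proof.
move=> mF; have -> : \bigcup_i F i = \big[setU/set0]_(t in I) F t.
  by rewrite -(bigcup_pred predT F); congr bigcup; apply/seteqP; split.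
have [//] : measurable (\big[setU/set0]_(t in I) F t) /\
  (mu (\big[setU/set0]_(t in I) F t) <= \sum_i mu (F i))%E.
elim/big_rec2 : _ => [|i x y _ [my le]]; first by rewrite measure0.
split; first exact: measurableU.
by apply: le_trans (measureU2 _ _ _) _ => //; apply: leeD.
Qed.

Lemma measurable_dist (d : measure_display) (T : measurableType d) (R : realType)
    (f g : T -> pt2 R) :
  measurable_fun setT f -> measurable_fun setT g ->
  measurable_fun setT (fun w => dist (f w) (g w)).
Proof.
move=> mf mg.
have m1 (h : T -> pt2 R) : measurable_fun setT h -> measurable_fun setT (fun w => (h w).1).
  by move=> mh; apply: (measurableT_comp measurable_fst).
have m2 (h : T -> pt2 R) : measurable_fun setT h -> measurable_fun setT (fun w => (h w).2).
  by move=> mh; apply: (measurableT_comp measurable_snd).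
apply: (measurableT_comp (f := @Num.sqrt R)).
  by apply: continuous_measurable_fun; exact: sqrt_continuous.
by apply: measurable_funD; apply: measurable_funX; apply: measurable_funB; auto.
Qed.

Lemma measurable_disk (R : realType) (rad : R) : measurable (disk rad).
Proof.
have -> : disk rad = (fun p : pt2 R => dist p (0, 0)) @^-1` `]-oo, rad].
  by apply/seteqP; split=> p /=; rewrite in_itv.
rewrite -[X in measurable X]setTI; apply: measurable_dist => //.
Qed.

(** A nonzero [fine (mu D)] makes [mu D] finite, as [fine] sends infinite values to 0; subtraction
    is then legitimate. *)
Lemma fine_measure_setCI (d : measure_display) (T : measurableType d) (R : realType)
    (mu : {measure set T -> \bar R}) (A D : set T) :
  measurable A -> measurable D -> fine (mu D) != 0 ->
  fine (mu (~` A `&` D)) = fine (mu D) - fine (mu (A `&` D)).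
Proof.
move=> mA mD.
have -> : mu D = (mu (~` A `&` D) + mu (A `&` D))%E.
  by rewrite (measureDI mu mD mA) setDE [D `&` ~` A]setIC [D `&` A]setIC.
have := measure_ge0 mu (A `&` D); have := measure_ge0 mu (~` A `&` D).
case: (mu (A `&` D)) (mu (~` A `&` D)) => [x| |] [y| |] //= _ _;
  by rewrite ?eqxx // addrK.
Qed.

Section RandomSDSet.
Variables (R : realType) (dO : measure_display) (Omega : measurableType dO).
Variables (P : probability Omega R) (n : nat) (rad : R).
Variables (pos : 'I_n -> Omega -> pt2 R) (dst : 'I_n -> Omega -> 'I_n).
Hypothesis n2 : (2 <= n)%N.
Hypothesis SD : random_SD_set P rad pos dst.

Local Notation u := (unif_disk rad).
Let q (i k : 'I_n) : R := if k != i then (n.-1)%:R^-1 else 0.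

Let q_ge0 i k : 0 <= q i k.
Proof. by rewrite /q; case: ifP => // _; rewrite invr_ge0. Qed.

Let q_sum i (S : pred 'I_n) : \sum_(k | S k) q i k <= #|S|%:R / (n.-1)%:R.
Proof.
rewrite -[#|S|]sum1_card natr_sum mulr_suml; apply: ler_sum => k _.
by rewrite /q mul1r; case: ifP => // _; rewrite invr_ge0.
Qed.

Let q_sum1 i : \sum_k q i k = 1.
Proof.
rewrite /q -big_mkcond sumr_const /=.
have -> : #|[pred k | k != i]| = n.-1.
  have := cardC (pred1 i); rewrite card1 card_ord.
  by rewrite (_ : #|predC (pred1 i)| = #|[pred k | k != i]|) //; lia.
by rewrite -[LHS]mulr_natl divff // pnatr_eq0; lia.
Qed.

Lemma SD_law_fibers (A : set (pt2 R)) (b : {ffun 'I_n -> bool}) (k : {ffun 'I_n -> 'I_n}) :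
  measurable A ->
  let g w := ([ffun i => pos i w \in A], [ffun i => dst i w]) in
  measurable (g @^-1` [set (b, k)]) /\
  P (g @^-1` [set (b, k)]) =
    (\prod_i (u (if b i then A else ~` A) * q i (k i)))%:E.
Proof.
move=> mA g; have [mpos [mdst law]] := SD.
pose B i := if b i then A else ~` A.
have mB i : measurable (B i) by rewrite /B; case: ifP => _ //; apply: measurableC.
have -> : g @^-1` [set (b, k)] =
    \bigcap_i (pos i @^-1` B i `&` dst i @^-1` [set k i]).
  apply/seteqP; split=> w /=.
    move=> [/ffunP bE /ffunP kE] i _; have := bE i; have := kE i.
    rewrite !ffunE /B => <- <-; split=> //=.
    by case: ifPn => /asboolP.
  move=> h; congr pair; apply/ffunP => i; rewrite !ffunE; have [/= + +] := h i I.
    rewrite /B; case: ifP => _ Ai _; first by apply/asboolP.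
    by apply/negbTE/asboolP.
  by [].
split; last by rewrite law.
apply: fin_bigcap_measurable => [|i _]; first exact: finite_finset.
apply: measurableI => //.
by rewrite -[X in measurable X]setTI; apply: mpos.
Qed.

(** For one set [A], the membership pattern [b] of the nodes and the destination map [k] form a
    finite-valued random element whose fibres are the rectangles of the joint law. Events that
    depend only on [(b, k)] thus become finite sums of product weights. *)
Lemma SD_law (A : set (pt2 R))
    (E : {ffun 'I_n -> bool} -> {ffun 'I_n -> 'I_n} -> bool) :
  measurable A ->
  let B := [set w | E [ffun i => pos i w \in A] [ffun i => dst i w]] in
  measurable B /\
  P B = (\sum_(b : {ffun 'I_n -> bool}) (\prod_i u (if b i then A else ~` A)) *
     \sum_(k | E b k) \prod_i q i (k i))%:E.
Proof.
move=> mA B.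
pose g w := ([ffun i => pos i w \in A], [ffun i => dst i w]).
have mg t : measurable (g @^-1` [set t]).
  by case: t => b k; have [] := SD_law_fibers b k mA.
have [mB PB] := finite_valued_law P (fun t => E t.1 t.2) mg.
split=> //; rewrite [LHS]PB.
rewrite (eq_bigr (fun t : {ffun 'I_n -> bool} * {ffun 'I_n -> 'I_n} =>
  (\prod_i u (if t.1 i then A else ~` A) *
   \prod_i q i (t.2 i))%:E)); last first.
  by move=> [b k] _; rewrite -big_split /=; have [] := SD_law_fibers b k mA.
rewrite sumEFin; congr (_%:E).
under [in RHS]eq_bigr => b _ do rewrite mulr_sumr.
by rewrite pair_big_dep /=.
Qed.

Lemma unif_disk_ge0 (A : set (pt2 R)) : 0 <= u A.
Proof.
rewrite /unif_disk divr_ge0 ?fine_ge0 ?measure_ge0 //.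
by rewrite mulr_ge0 ?pi_ge0 ?sqr_ge0.
Qed.

(* The area of the disk is not computed: the total mass of the joint law forces it. *)
Lemma unif_diskT : u setT = 1.
Proof.
have [_] := SD_law (fun _ _ => true) (@measurableT _ (pt2 R)).
rewrite /=.
have -> : [set w : Omega | true] = setT by apply/seteqP; split.
rewrite probability_setT => -[].
under eq_bigr => b _.
  rewrite -(bigA_distr_bigA q) /=.
  under [X in _ * X]eq_bigr => i _ do rewrite q_sum1.
  rewrite [X in _ * X]big1 // mulr1. over.
rewrite -(bigA_distr_bigA (fun (i : 'I_n) (b : bool) => u (if b then setT else ~` setT))) /=.
have e : \sum_b u (if b then setT else ~` setT) = u setT.
  rewrite big_bool /= setCT.
  by rewrite [X in _ + X](_ : _ = 0) ?addr0 // /unif_disk set0I /leb2 measure0 mul0r.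
rewrite e.
rewrite prodr_const card_ord => /esym/eqP.
by rewrite pexpr_eq1 ?unif_disk_ge0 // => [/eqP//|]; lia.
Qed.

Lemma unif_diskC (A : set (pt2 R)) : measurable A -> u (~` A) = 1 - u A.
Proof.
move=> mA; have := unif_diskT; rewrite /unif_disk setTI => D1.
rewrite fine_measure_setCI //; last 2 first.
- exact: measurable_disk.
- by apply/eqP => D0; move/eqP: D1; rewrite /leb2 D0 mul0r eq_sym oner_eq0.
by rewrite mulrBl; congr (_ - _).
Qed.

Let b_sum (A : set (pt2 R)) : measurable A ->
  \sum_b u (if b then A else ~` A) = 1.
Proof. by move=> mA; rewrite big_bool /= unif_diskC // addrC subrK. Qed.

Let q_prod_ge0 (k : {ffun 'I_n -> 'I_n}) : 0 <= \prod_i q i (k i).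
Proof. by apply: prodr_ge0. Qed.

Let q_prod_le1 (E : pred {ffun 'I_n -> 'I_n}) : \sum_(k | E k) \prod_i q i (k i) <= 1.
Proof.
apply: (@le_trans _ _ (\sum_(k : {ffun 'I_n -> 'I_n}) \prod_i q i (k i))).
  by rewrite [leRHS](bigID E) /= lerDl sumr_ge0.
by rewrite -(bigA_distr_bigA q) /= big1.
Qed.

(** Only the pattern that is false everywhere contributes, with weight [(1 - u A) ^ n]. *)
Lemma SD_void (A : set (pt2 R)) : measurable A ->
  let B := [set w | [forall i, pos i w \notin A]] in
  measurable B /\ (P B <= (expR (- (n%:R * u A)))%:E)%E.
Proof.
move=> mA B.
pose E (b : {ffun 'I_n -> bool}) (k : {ffun 'I_n -> 'I_n}) := [forall i, ~~ b i].
have [+ +] := SD_law E mA.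
have -> : [set w | E [ffun i => pos i w \in A] [ffun i => dst i w]] = B.
  by rewrite /B /E; apply/seteqP; split=> w /= /forallP h; apply/forallP => i;
    have := h i; rewrite ffunE.
move=> mB ->; split=> //; rewrite lee_fin.
rewrite (bigD1 [ffun=> false]) //= [X in _ + X]big1 ?addr0; last first.
  move=> b bN; rewrite [X in _ * X]big_pred0 ?mulr0 // => k.
  apply/negbTE; apply: contra bN => /forallP bF; apply/eqP/ffunP => i.
  by rewrite ffunE; apply/negbTE.
apply: le_trans (ler_piMr _ (q_prod_le1 _)) _.
  by apply: prodr_ge0 => i _; apply: unif_disk_ge0.
under eq_bigr => i _ do rewrite ffunE.
rewrite prodr_const card_ord unif_diskC // -[X in expR X]mulrN expRM_natl.
rewrite lerXn2r ?nnegrE ?expR_ge0 //.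
  by rewrite -unif_diskC // unif_disk_ge0.
exact: expR_ge1Dx.
Qed.

(** Two applications of Chernoff's bound. The number of nodes in [A] has mean at most [n * p]. Once
    at most [4 * n * p] nodes lie in [A], each destination is in [A] with probability at most
    [4 * n * p / (n - 1) <= 8 * p], so the number of destinations has conditional mean at most
    [8 * n * p], and 32 is four times 8. *)
Lemma SD_crowd (A : set (pt2 R)) (p : R) : measurable A -> u A <= p -> 0 <= p ->
  let B := [set w | (4 * (n%:R * p) < #|[pred i | pos i w \in A]|%:R) ||
                    (32 * (n%:R * p) < #|[pred i | pos (dst i w) w \in A]|%:R)] in
  measurable B /\ (P B <= (2 * expR (- (n%:R * p)))%:E)%E.
Proof.
move=> mA uA p0 B.
pose E1 (b : {ffun 'I_n -> bool}) := 4 * (n%:R * p) < #|[pred i | b i]|%:R.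
pose E2 (b : {ffun 'I_n -> bool}) (k : {ffun 'I_n -> 'I_n}) :=
  32 * (n%:R * p) < #|[pred i | b (k i)]|%:R.
have [+ +] := SD_law (fun b k => E1 b || E2 b k) mA.
have -> : [set w | E1 [ffun i => pos i w \in A] ||
     E2 [ffun i => pos i w \in A] [ffun i => dst i w]] = B.
  rewrite /B /E1 /E2; apply/seteqP; split=> w /=.
    congr (is_true (_ || _)); congr (_ < _%:R); apply: eq_card => i;
    by rewrite !inE !ffunE.
  congr (is_true (_ || _)); congr (_ < _%:R); apply: eq_card => i;
  by rewrite !inE !ffunE.
move=> mB ->; split=> //; rewrite lee_fin.
have wu0 (b : {ffun 'I_n -> bool}) : 0 <= \prod_i u (if b i then A else ~` A).
  by apply: prodr_ge0 => i _; apply: unif_disk_ge0.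
have np0 : 0 <= n%:R * p by rewrite mulr_ge0.
(* The pattern [b] is fixed and only the destinations are random; a crowded pattern is charged its
   full weight. *)
have inner b : \sum_(k | E1 b || E2 b k) \prod_i q i (k i) <=
    (E1 b)%:R + expR (- (n%:R * p)).
  have [bE|bE] /= := boolP (E1 b).
    by apply: le_trans (q_prod_le1 _) _; rewrite lerDl expR_ge0.
  rewrite add0r; apply: (@le_trans _ _ (expR (- (8 * (n%:R * p))))).
    apply: (@prod_weight_chernoff _ _ _ q (fun _ => [pred k | b k])) => //.
      apply: (@le_trans _ _ (\sum_(i < n) #|[pred k | b k]|%:R / n.-1%:R)).
        by apply: ler_sum => i _; apply: q_sum.
      rewrite sumr_const card_ord -[leLHS]mulr_natl.
      move: bE; rewrite /E1 -leNgt => bE.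
      rewrite mulrA ler_pdivrMr; last by rewrite ltr0n; lia.
      apply: (@le_trans _ _ (n%:R * (4 * (n%:R * p)))); first by rewrite ler_wpM2l.
      (* The inequality needed is [n <= 2 * (n - 1)], valid since [2 <= n]. *)
      have -> : n%:R = n.-1%:R + 1 :> R by rewrite -{1}(prednK (ltnW n2)) -natr1.
      have : 1 <= n.-1%:R :> R by rewrite ler1n; lia.
      move: (n.-1%:R) => x x1.
      have : 0 <= (x + 1) * p * (x - 1) by rewrite !mulr_ge0 //; lra.
      by lra.
    by lra.
  by rewrite ler_expR; lra.
apply: (@le_trans _ _ (\sum_(b : {ffun 'I_n -> bool}) (\prod_i u (if b i then A else ~` A)) *
   ((E1 b)%:R + expR (- (n%:R * p))))).
  by apply: ler_sum => b _; rewrite ler_wpM2l.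
under eq_bigr => b _ do rewrite mulrDr.
rewrite big_split /= -mulr_suml.
have -> : \sum_(b : {ffun 'I_n -> bool}) \prod_i u (if b i then A else ~` A) = 1.
  rewrite -(bigA_distr_bigA (fun (i : 'I_n) (b : bool) => u (if b then A else ~` A))) /=.
  by rewrite big1 // => i _; apply: b_sum.
rewrite mul1r [leRHS]mulr_natl mulr2n lerD2r.
under eq_bigr => b _ do rewrite mulr_natr mulrb.
rewrite -big_mkcond /=.
apply: (@prod_weight_chernoff _ _ _
  (fun i (b : bool) => u (if b then A else ~` A)) (fun _ => id)) => //.
- by move=> i b; apply: unif_disk_ge0.
- by move=> i; apply: b_sum.
under eq_bigr => i _ do rewrite big_mkcond big_bool /= addr0.
by rewrite sumr_const card_ord -[leLHS]mulr_natl ler_wpM2l.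
Qed.

(** Applied to the disk itself, which contains the nodes only almost surely; the exceptional null
    event joins the bad event. *)
Lemma SD_outside (A : set (pt2 R)) : measurable A -> u A = 1 ->
  let B := [set w | ~~ [forall i, pos i w \in A]] in
  measurable B /\ P B = 0%E.
Proof.
move=> mA uA B.
pose E (b : {ffun 'I_n -> bool}) (k : {ffun 'I_n -> 'I_n}) := ~~ [forall i, b i].
have [+ +] := SD_law E mA.
have -> : [set w | E [ffun i => pos i w \in A] [ffun i => dst i w]] = B.
  by rewrite /B /E; apply/seteqP; split=> w /=; apply: contra => /forallP h;
    apply/forallP => i; have := h i; rewrite ffunE.
move=> mB ->; split=> //; congr EFin; apply: big1 => b _.
have [|bE] := boolP [forall i, b i].
  by move=> bT; rewrite [X in _ * X]big_pred0 ?mulr0 // => k; rewrite /E bT.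
move: bE; rewrite negb_forall => /existsP[i /negbTE bi].
by rewrite (bigD1 i) //= bi unif_diskC // uA subrr !mul0r.
Qed.

Lemma SD_dst_neq :
  let B := [set w | ~~ [forall i, dst i w != i]] in
  measurable B /\ P B = 0%E.
Proof.
move=> B.
pose E (b : {ffun 'I_n -> bool}) (k : {ffun 'I_n -> 'I_n}) := ~~ [forall i, k i != i].
have [+ +] := SD_law E (@measurableT _ (pt2 R)).
have -> : [set w | E [ffun i => pos i w \in setT] [ffun i => dst i w]] = B.
  by rewrite /B /E; apply/seteqP; split=> w /=; apply: contra => /forallP h;
    apply/forallP => i; have := h i; rewrite ffunE.
move=> mB ->; split=> //; congr EFin; apply: big1 => b _.
rewrite [X in _ * X]big1 ?mulr0 // => k; rewrite /E negb_forall => /existsP[i].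
by rewrite negbK => ki; rewrite (bigD1 i) //= /q ki mul0r.
Qed.

End RandomSDSet.

(** * Routes and schedules *)

Lemma foldr_maxn_le (s : seq nat) (B : nat) :
  {in s, forall x, (x <= B)%N} -> (foldr maxn 0%N s <= B)%N.
Proof.
elim: s => //= x s IH h; rewrite geq_max h ?mem_head //=.
by apply: IH => y ys; apply: h; rewrite inE ys orbT.
Qed.

Lemma path_zip_rel (T : eqType) (e : rel T) (x : T) (p : seq T) (a b : T) :
  path e x p -> (a, b) \in zip (belast x p) p -> e a b.
Proof.
elim: p x => //= y p IH x /andP[exy py].
by rewrite inE => /orP[/eqP[-> ->]//|]; apply: IH.
Qed.

(** Both ends of every edge are kept in [V], so removing loops from a path leaves its nodes in [V].
    Distinct endpoints keep the path nonempty. *)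
Lemma connect_uniq_path (T : finType) (e : rel T) (V : pred T) (x y : T) :
  x != y -> x \in V ->
  connect [rel a b | [&& e a b, a \in V & b \in V]] x y ->
  exists p : seq T, [/\ p <> [::], path e x p, last x p = y, uniq (x :: p) &
    {subset x :: p <= V}].
Proof.
move=> xy xV /connectP[p0 ep0 yE].
have : last x p0 = y by [].
case/shortenP: ep0 => p ep up _ lp; exists p; split=> //.
- by move=> p_nil; move: lp xy; rewrite p_nil /= => ->; rewrite eqxx.
- by apply: sub_path ep => a b /andP[].
move=> z; rewrite inE => /orP[/eqP->//|].
elim: p x {xy xV yE up lp} ep => //= a p IH x /andP[/and3P[_ _ aV] ep].
by rewrite inE => /orP[/eqP->//|]; apply: IH ep.
Qed.

Section Schedule.
Variables (n : nat) (dest : 'I_n -> 'I_n) (p : 'I_n -> seq 'I_n).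
Variables (G : eqType) (g : 'I_n -> G) (col : G -> nat) (K L : nat).
Hypothesis p_neq0 : forall i, p i <> [::].
Hypothesis p_last : forall i, last i (p i) = dest i.
Hypothesis p_uniq : forall i, uniq (i :: p i).
Hypothesis colK : forall Q, (col Q < K)%N.

(** A hop is encoded by its route and its transmitter; this determines it because a route repeats no
    node. *)
Definition cell_hops (Q : G) : seq ('I_n * 'I_n) :=
  [seq x <- enum {: 'I_n * 'I_n} | (x.2 \in belast x.1 (p x.1)) && (g x.2 == Q)].

Hypothesis loadL : forall Q, (size (cell_hops Q) <= L)%N.

(** Time is divided into rounds of [K] slots: the remainder is the colour of the transmitter's cell,
    the quotient the rank of the hop within that cell. The successor makes slots positive. *)
Definition hop_slot (x : 'I_n * 'I_n) : nat :=
  (index x (cell_hops (g x.2)) * K + col (g x.2)).+1.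

Definition scheduled (i : 'I_n) : seq (shop n) :=
  [seq (y, hop_slot (i, y.1)) | y <- zip (belast i (p i)) (p i)].

Lemma scheduled_tx i : [seq x.1.1 | x <- scheduled i] = belast i (p i).
Proof.
by rewrite /scheduled -map_comp -[RHS](unzip1_zip (t := p i)) ?size_belast.
Qed.

Lemma scheduled_rx i : [seq x.1.2 | x <- scheduled i] = p i.
Proof.
by rewrite /scheduled -map_comp -[RHS](unzip2_zip (s := belast i (p i))) ?size_belast.
Qed.

Lemma mem_scheduled x : x \in all_hops scheduled ->
  exists2 i, x.1 \in zip (belast i (p i)) (p i) &
             x.1.1 \in belast i (p i) /\ x.2 = hop_slot (i, x.1.1).
Proof.
case/flattenP => s /mapP[i _ ->] xs; exists i.
  by case/mapP: xs => y yz ->.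
split; last by case/mapP: xs => y yz ->.
by rewrite -scheduled_tx; apply: map_f.
Qed.

Lemma hop_slot_inj (x y : 'I_n * 'I_n) :
  x.2 \in belast x.1 (p x.1) -> y.2 \in belast y.1 (p y.1) ->
  hop_slot x = hop_slot y ->
  col (g x.2) = col (g y.2) /\ (g x.2 = g y.2 -> x = y).
Proof.
move=> xp yp [slotE].
have K0 : (0 < K)%N by apply: leq_ltn_trans (colK (g x.2)).
have colE : col (g x.2) = col (g y.2).
  by have := congr1 (modn^~ K) slotE; rewrite !modnMDl !modn_small.
split=> // gE; move: slotE; rewrite colE => /addIn /eqP.
rewrite eqn_pmul2r // gE => /eqP idx.
have mem z : z.2 \in belast z.1 (p z.1) -> g z.2 = g y.2 -> z \in cell_hops (g y.2).
  by move=> zp zg; rewrite mem_filter zp zg eqxx mem_enum.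
by rewrite -(nth_index x (mem _ xp gE)) idx nth_index // mem.
Qed.

Lemma scheduled_system : is_system dest scheduled.
Proof.
split=> [i|].
  rewrite /sched_route scheduled_tx scheduled_rx; split.
    by move=> s0; apply: (p_neq0 (i := i)); rewrite -scheduled_rx s0.
  split; first by rewrite cats1 -p_last -lastI.
  split; first exact: p_uniq.
  by apply/allP => x /mapP[y _ ->].
rewrite /compatible /all_hops map_flatten -map_comp.
have -> : [seq ((map (fun x : shop n => (x.1.1, x.2))) \o scheduled) i | i <- enum 'I_n] =
   [seq [seq (t, hop_slot (i, t)) | t <- belast i (p i)] | i <- enum 'I_n].
  apply: eq_map => i /=; rewrite -scheduled_tx /scheduled -!map_comp.
  exact: eq_map.
apply: allpairs_uniq_dep; first exact: enum_uniq.
  by move=> i _; have := p_uniq i; rewrite lastI rcons_uniq => /andP[].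
move=> [i t] [i' t'] /allpairsPdep[a [b [_ bp [-> ->]]]].
move=> /allpairsPdep[a' [b' [_ bp' [-> ->]]]] /= [bb' slots].
(* Hops of one transmitter belong to one cell, so equal slots mean equal ranks, hence equal hops. *)
have [_ h] := @hop_slot_inj (a, b) (a', b') bp bp' (congr1 S slots).
by have [-> ->] := h (congr1 g bb').
Qed.

Lemma scheduled_period : (period scheduled <= K * L)%N.
Proof.
apply: foldr_maxn_le => _ /mapP[x /mem_scheduled[i _ [tx ->]] ->].
rewrite /hop_slot /= [leqRHS]mulnC.
set Q := g _; set y := (i, _).
have yQ : y \in cell_hops Q by rewrite mem_filter mem_enum tx eqxx.
have lt : (index y (cell_hops Q) < L)%N.
  by apply: leq_trans (loadL Q); rewrite index_mem.
have := colK Q; move: lt; set j := index _ _; move=> jL cK.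
apply: (@leq_trans (j.+1 * K)%N); last by rewrite leq_mul2r jL orbT.
by rewrite mulSn [leqRHS]addnC ltn_add2l.
Qed.

End Schedule.

(** * Cells *)

Lemma connect_chain (T : finType) (e : rel T) (f : nat -> T) (a b : nat) :
  symmetric e ->
  (forall x, minn a b <= x -> x < maxn a b -> e (f x) (f x.+1))%N ->
  connect e (f a) (f b).
Proof.
move=> se; wlog ab : a b / (a <= b)%N.
  move=> h; case/orP: (leq_total a b) => ab; first exact: h.
  by rewrite minnC maxnC => hf; rewrite (sym_connect_sym se); apply: (h b a).
move/minn_idPl: (ab) => ->; move/maxn_idPr: (ab) => -> ef.
elim: b ab ef => [|b IH]; first by rewrite leqn0 => /eqP->.
rewrite leq_eqVlt => /orP[/eqP->//|ab] ef.
apply: (connect_trans (IH ab _)).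
  by move=> x ax xb; apply: ef => //; apply: ltn_trans xb _.
by apply: connect1; apply: ef.
Qed.

Section Grid.
Variable R : realType.
Implicit Types (rad l s x y : R) (p q : pt2 R).

(** The grid starts at [- rad], so that natural indices suffice for the disk; half-open intervals
    make the cells disjoint. *)
Definition cell rad l (a : nat) : set R :=
  [set` `[a%:R * l - rad, a.+1%:R * l - rad[].

Definition box rad l (a b : nat) : set (pt2 R) := cell rad l a `*` cell rad l b.

Definition gidx rad l x : nat := Num.truncn ((x + rad) / l).

Definition ncells rad l : nat := (Num.truncn (2 * rad / l)).+1.

Lemma diskP rad p : 0 <= rad -> disk rad p <-> p.1 ^+ 2 + p.2 ^+ 2 <= rad ^+ 2.
Proof.
move=> r0; rewrite /disk /dist /= !subr0.
have e0 : 0 <= p.1 ^+ 2 + p.2 ^+ 2 by rewrite addr_ge0 ?sqr_ge0.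
by rewrite -ler_sqr ?nnegrE ?sqrtr_ge0 // sqr_sqrtr.
Qed.

Lemma distC p q : dist p q = dist q p.
Proof. by rewrite /dist -sqrrN -[X in _ + X]sqrrN !opprB. Qed.

Lemma disk_coord rad p : 0 <= rad -> disk rad p ->
  (- rad <= p.1 <= rad) /\ (- rad <= p.2 <= rad).
Proof.
move=> r0 /(diskP _ r0) h.
have h1 := sqr_ge0 p.1; have h2 := sqr_ge0 p.2.
by split; rewrite -ler_norml -ler_sqr ?nnegrE // real_normK ?num_real //; lra.
Qed.

Lemma cell_gidx rad l x : 0 < l -> - rad <= x -> cell rad l (gidx rad l x) x.
Proof.
move=> l0 xr; rewrite /cell /= in_itv /=.
have t0 : 0 <= (x + rad) / l by rewrite divr_ge0 ?(ltW l0) //; lra.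
have := truncnS_gt ((x + rad) / l).
have : (gidx rad l x)%:R <= (x + rad) / l by rewrite truncn_le.
rewrite ler_pdivlMr // ltr_pdivrMr // -/(gidx rad l x) => h1 h2.
by apply/andP; split; lra.
Qed.

Lemma gidx_cell rad l x a : 0 < l -> cell rad l a x -> gidx rad l x = a.
Proof.
move=> l0; rewrite /cell /= in_itv /= => /andP[h1 h2].
apply: truncn_def; rewrite ler_pdivlMr // ltr_pdivrMr //; apply/andP; split; lra.
Qed.

Lemma gidx_lt rad l x : 0 < l -> x <= rad -> (gidx rad l x < ncells rad l)%N.
Proof.
move=> l0 xr; rewrite ltnS; apply: le_truncn.
by rewrite ler_pM2r ?invr_gt0 //; lra.
Qed.

(** This is where the contraction pays off. A point [q] of a cell between the two ends satisfies
    [|q.1| <= |x| + l] for one of the ends [x], and [|q.2| <= |y| + l]. With [u = rad - 2 * l] the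
    squared norm of [q] is at most [u ^ 2 + 4 * l * u + 2 * l ^ 2], below [(u + 2 * l) ^ 2]. *)
Lemma box_sub_disk rad l x1 x2 y a q : 0 < l -> 2 * l < rad ->
  x1 ^+ 2 + y ^+ 2 <= (rad - 2 * l) ^+ 2 ->
  x2 ^+ 2 + y ^+ 2 <= (rad - 2 * l) ^+ 2 ->
  (minn (gidx rad l x1) (gidx rad l x2) <= a <= maxn (gidx rad l x1) (gidx rad l x2))%N ->
  cell rad l a q.1 -> cell rad l (gidx rad l y) q.2 ->
  q.1 ^+ 2 + q.2 ^+ 2 <= rad ^+ 2.
Proof.
move=> l0 lr.
wlog le12 : x1 x2 / (gidx rad l x1 <= gidx rad l x2)%N.
  move=> h; case/orP: (leq_total (gidx rad l x1) (gidx rad l x2)) => g12 h1 h2 hm.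
    exact: (h x1 x2).
  by apply: (h x2 x1) => //; move: hm; rewrite minnC maxnC.
move=> h1 h2; move/minn_idPl: (le12) => ->; move/maxn_idPr: (le12) => -> /andP[a1 a2].
set u := rad - 2 * l in h1 h2; have u0 : 0 < u by rewrite /u; lra.
have lenorm (x : R) : x ^+ 2 + y ^+ 2 <= u ^+ 2 -> `|x| <= u /\ `|y| <= u.
  move=> h; have hx := sqr_ge0 x; have hy := sqr_ge0 y.
  by split; rewrite -ler_sqr ?nnegrE ?(ltW u0) // real_normK ?num_real //; lra.
have [nx1 ny] := lenorm _ h1; have [nx2 _] := lenorm _ h2.
have ge (x : R) : `|x| <= u -> - rad <= x by rewrite ler_norml /u => /andP[? _]; lra.
have := cell_gidx l0 (ge _ nx1); have := cell_gidx l0 (ge _ nx2).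
have := cell_gidx l0 (ge _ ny).
rewrite /cell /= !in_itv /= -!natr1.
move=> /andP[y1 y2] /andP[x2a _] /andP[_ x1b] /andP[q1 q2] /andP[q3 q4].
have al1 : (gidx rad l x1)%:R * l <= a%:R * l by rewrite ler_wpM2r ?ler_nat ?(ltW l0).
have al2 : a%:R * l <= (gidx rad l x2)%:R * l by rewrite ler_wpM2r ?ler_nat ?(ltW l0).
have q2y : `|q.2| <= `|y| + l.
  by rewrite -[q.2](subrK y) (le_trans (ler_normD _ _)) // addrC lerD2l ler_norml; lra.
have final (x : R) : `|x| <= u -> x ^+ 2 + y ^+ 2 <= u ^+ 2 -> `|q.1| <= `|x| + l ->
    q.1 ^+ 2 + q.2 ^+ 2 <= rad ^+ 2.
  move=> xu hx q1x; have xn := normr_ge0 x; have yn := normr_ge0 y.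
  have : q.1 ^+ 2 <= (`|x| + l) ^+ 2
    by rewrite -[q.1 ^+ 2]real_normK ?num_real // ler_sqr ?nnegrE //; lra.
  have : q.2 ^+ 2 <= (`|y| + l) ^+ 2
    by rewrite -[q.2 ^+ 2]real_normK ?num_real // ler_sqr ?nnegrE //; lra.
  move: hx; rewrite -[x ^+ 2]real_normK ?num_real // -[y ^+ 2]real_normK ?num_real //.
  have -> : rad = u + 2 * l by rewrite /u; ring.
  have : 0 <= l * (u - `|x|) by rewrite mulr_ge0 ?(ltW l0) //; lra.
  have : 0 <= l * (u - `|y|) by rewrite mulr_ge0 ?(ltW l0) //; lra.
  have := sqr_ge0 l.
  by move: (`|x|) (`|y|) => X Y; rewrite !sqrrD; lra.
(* The sign of [q.1] selects the end of the row that dominates it: the right one for a nonnegative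
   coordinate, the left one otherwise. *)
have [q0|q0] := leP 0 q.1.
  apply: (final x2) => //; rewrite ger0_norm //; have := ler_norm x2; lra.
apply: (final x1) => //; rewrite ltr0_norm //; have := ler_norm (- x1); rewrite normrN; lra.
Qed.
End Grid.

(** * Routing in a typical configuration *)

(* The flag [k.1] selects the second coordinate, [k.2] the contracted plane. *)
Definition coord (R : realType) (s : R) (k : bool * bool) (p : pt2 R) : R :=
  (if k.2 then s else 1) * (if k.1 then p.2 else p.1).

Definition slab (R : realType) (rad l s : R) (k : bool * bool) (a : nat) : set (pt2 R) :=
  [set p | cell rad l a (coord s k p)].

(** The parameter [q] stands for [n * rho], and 4 and 32 are the thresholds of [SD_crowd].
    Uncontracted slabs control the routes that begin or end at a node of a given cell, contracted
    ones the routes whose L passes through it. *)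
Definition typical (R : realType) (n : nat) (rad l s q : R)
    (pos : 'I_n -> pt2 R) (dst : 'I_n -> 'I_n) : Prop :=
  [/\ forall i, disk rad (pos i),
      forall a b, (a < ncells rad l)%N -> (b < ncells rad l)%N ->
        box rad l a b `<=` disk rad -> exists i, box rad l a b (pos i) &
      forall k a, (a < ncells rad l)%N ->
        #|[pred i | pos i \in slab rad l s k a]|%:R <= 4 * q /\
        #|[pred i | pos (dst i) \in slab rad l s k a]|%:R <= 32 * q].

Section Routing.
Variables (R : realType) (n : nat) (C D rad q : R).
Variables (pos : 'I_n -> pt2 R) (dst : 'I_n -> 'I_n).
Hypotheses (C0 : 0 < C) (C_rad : C < rad / 2) (D0 : 0 < D).
Hypothesis n0 : (0 < n)%N.
Hypothesis dstN : forall i, dst i != i.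

Let l : R := C / 8.
Let s : R := 1 - 2 * l / rad.
Hypothesis typ : typical rad l s q pos dst.

Let l0 : 0 < l. Proof. by rewrite /l divr_gt0. Qed.
Let rad0 : 0 < rad. Proof. by move: C0 C_rad; lra. Qed.
Let l_rad : 16 * l < rad. Proof. by move: C_rad; rewrite /l; lra. Qed.
Let srad : s * rad = rad - 2 * l.
Proof. by rewrite /s mulrBl mul1r mulfVK // gt_eqF. Qed.
Let s_bounds : 0 < s /\ s < 1.
Proof.
have h := srad; move: l0 l_rad => l0' lr'.
split; rewrite -(ltr_pM2r rad0) ?mul0r ?mul1r h; lra.
Qed.

Let gd (x : R) := gidx rad l x.
(** The route is drawn between the cells of the contracted positions, which lie in the disk;
    interference is governed by the cells of the true positions, [real_cell]. *)
Let home i := (gd (s * (pos i).1), gd (s * (pos i).2)).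
Let real_cell i := (gd (pos i).1, gd (pos i).2).

Let pos_bounds i : (- rad <= (pos i).1 <= rad) /\ (- rad <= (pos i).2 <= rad).
Proof. by case: typ => h _ _; apply: disk_coord; rewrite ?ltW. Qed.

Let coord_bounds k i : - rad <= coord s k (pos i) <= rad.
Proof.
have [s0 s1] := s_bounds.
have aux (x : R) : - rad <= x <= rad -> - rad <= s * x <= rad.
  rewrite -!ler_norml normrM (gtr0_norm s0) => hx.
  by apply: le_trans hx; rewrite ler_piMl // ltW.
have [h1 h2] := pos_bounds i.
by rewrite /coord; case: k => [[] []] /=; rewrite ?mul1r //; apply: aux.
Qed.

Let count_le k a :
  #|[pred i | gd (coord s k (pos i)) == a]|%:R <= 4 * q /\
  #|[pred i | gd (coord s k (pos (dst i))) == a]|%:R <= 32 * q.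
Proof.
have gd_lt i : (gd (coord s k (pos i)) < ncells rad l)%N.
  by apply: gidx_lt => //; have /andP[] := coord_bounds k i.
have [_ _ h] := typ.
have [aN|aN] := ltnP a (ncells rad l); last first.
  (* No node has an index beyond the grid; the bounds at index 0 serve only to show that the
     thresholds are nonnegative. *)
  have [x y] := h k 0%N isT.
  have x0 := le_trans (ler0n _ _) x; have y0 := le_trans (ler0n _ _) y.
  split.
    by rewrite eq_card0 // => i; apply/negbTE; rewrite inE ltn_eqF // (leq_trans (gd_lt i)).
  by rewrite eq_card0 // => i; apply/negbTE; rewrite inE ltn_eqF // (leq_trans (gd_lt (dst i))).
have sub i : gd (coord s k (pos i)) == a -> pos i \in slab rad l s k a.
  move=> /eqP <-; rewrite inE; apply: cell_gidx => //.
  by have /andP[] := coord_bounds k i.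
have [x y] := h k a aN.
by split; [apply: le_trans x|apply: le_trans y]; rewrite ler_nat;
  apply: subset_leq_card; apply/fintype.subsetP => i; rewrite !inE => /sub; rewrite inE.
Qed.

Let full (Q : nat * nat) := box rad l Q.1 Q.2 `<=` disk rad.

Let i0 : 'I_n := Ordinal n0.
(** The relay of a cell. The default [i0] is returned for empty cells only, hence never for a cell
    inside the disk. *)
Let rep (Q : nat * nat) : 'I_n :=
  odflt i0 [pick i | pos i \in box rad l Q.1 Q.2].

(** A box contains its lower left corner, which is then a point of the disk and has coordinates at
    most [rad]. *)
Let ncells_gt (Q : nat * nat) : full Q ->
  (Q.1 < ncells rad l)%N /\ (Q.2 < ncells rad l)%N.
Proof.
move=> fQ; pose p : pt2 R := (Q.1%:R * l - rad, Q.2%:R * l - rad).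
have cQ a : cell rad l a (a%:R * l - rad).
  by rewrite /cell /= in_itv /= lexx /= ltrD2r ltr_pM2r // ltr_nat.
have pQ : box rad l Q.1 Q.2 p by split; apply: cQ.
have [/andP[_ h1] /andP[_ h2]] := disk_coord (ltW rad0) (fQ _ pQ).
by split; rewrite -[X in (X < _)%N](gidx_cell l0 (cQ _)); apply: gidx_lt.
Qed.

Let repP Q : full Q -> box rad l Q.1 Q.2 (pos (rep Q)).
Proof.
move=> fQ; have [a1 a2] := ncells_gt fQ.
have [_ h _] := typ; have [i iQ] := h _ _ a1 a2 fQ.
rewrite /rep; case: pickP => [j /=|/(_ i)]; first by rewrite inE.
by rewrite mem_set.
Qed.

Let rep_cell Q : full Q -> real_cell (rep Q) = Q.
Proof.
by move=> /repP[h1 h2]; rewrite /real_cell /gd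
  (gidx_cell l0 h1) (gidx_cell l0 h2) -surjective_pairing.
Qed.

Let between (a b x : nat) := (minn a b <= x <= maxn a b)%N.

Let betweenL a b : between a b a.
Proof. by rewrite /between geq_minl leq_maxl. Qed.
Let betweenR a b : between a b b.
Proof. by rewrite /between geq_minr leq_maxr. Qed.

(* The squared norms of the corners (x_d, y_s) and (x_s, y_d) add up to those of
   the source and the destination, so at least one corner lies in the disk. *)
Let corner i := (pos (dst i)).1 ^+ 2 + (pos i).2 ^+ 2 <= rad ^+ 2.

(** The L bends at a corner whose uncontracted version lies in the disk: source row then destination
    column, or else source column then destination row. *)
Let route_cells i : pred (nat * nat) := fun Q =>
  if corner i then
    (Q.2 == (home i).2) && between (home i).1 (home (dst i)).1 Q.1 ||
    (Q.1 == (home (dst i)).1) && between (home i).2 (home (dst i)).2 Q.2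
  else
    (Q.1 == (home i).1) && between (home i).2 (home (dst i)).2 Q.2 ||
    (Q.2 == (home (dst i)).2) && between (home i).1 (home (dst i)).1 Q.1.

(** Each leg joins two points of the disk that share a coordinate, so [box_sub_disk] applies after
    contraction; a vertical leg is a horizontal one with the coordinates exchanged. *)
Let route_full i Q : route_cells i Q -> full Q.
Proof.
have [s0 s1] := s_bounds.
have [hd _ _] := typ.
have ssq (x y : R) : x ^+ 2 + y ^+ 2 <= rad ^+ 2 ->
    (s * x) ^+ 2 + (s * y) ^+ 2 <= (rad - 2 * l) ^+ 2.
  by rewrite -srad !exprMn -mulrDr ler_pM2l // exprn_gt0.
have sqC (x y : R) : x ^+ 2 + y ^+ 2 <= rad ^+ 2 -> y ^+ 2 + x ^+ 2 <= rad ^+ 2.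
  by rewrite addrC.
have l2 : 2 * l < rad by move: l0 l_rad; lra.
have hi := iffLR (diskP _ (ltW rad0)) (hd i).
have hdi := iffLR (diskP _ (ltW rad0)) (hd (dst i)).
have horiz x1 x2 y : x1 ^+ 2 + y ^+ 2 <= rad ^+ 2 -> x2 ^+ 2 + y ^+ 2 <= rad ^+ 2 ->
    Q.2 = gd (s * y) -> between (gd (s * x1)) (gd (s * x2)) Q.1 -> full Q.
  move=> h1 h2 Q2 b p [p1 p2]; apply/(diskP _ (ltW rad0)).
  apply: (box_sub_disk l0 l2 (ssq _ _ h1) (ssq _ _ h2) b) => //.
  by rewrite /= -/(gd _) -Q2.
have vert x1 x2 y : x1 ^+ 2 + y ^+ 2 <= rad ^+ 2 -> x2 ^+ 2 + y ^+ 2 <= rad ^+ 2 ->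
    Q.1 = gd (s * y) -> between (gd (s * x1)) (gd (s * x2)) Q.2 -> full Q.
  move=> h1 h2 Q1 b p [p1 p2]; apply/(diskP _ (ltW rad0)); rewrite addrC.
  apply: (box_sub_disk (q := (p.2, p.1)) l0 l2 (ssq _ _ h1) (ssq _ _ h2) b) => //.
  by rewrite /= -/(gd _) -Q1.
rewrite /route_cells; case: ifPn => [c|c] /orP[] /andP[/eqP e b].
- exact: horiz e b.
- by apply: vert e b; apply: sqC.
- have c' : (pos i).1 ^+ 2 + (pos (dst i)).2 ^+ 2 <= rad ^+ 2.
    by move: c; rewrite /corner -ltNge; lra.
  by apply: vert e b; apply: sqC.
- have c' : (pos i).1 ^+ 2 + (pos (dst i)).2 ^+ 2 <= rad ^+ 2.
    by move: c; rewrite /corner -ltNge; lra.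
  exact: horiz e b.
Qed.

Let adj : rel 'I_n := fun i j => dist (pos i) (pos j) <= C.

(** Since [C = 8 * l], it suffices that [9 + 9 <= 64]. *)
Let near i j : `|(pos i).1 - (pos j).1| <= 3 * l -> `|(pos i).2 - (pos j).2| <= 3 * l ->
  adj i j.
Proof.
move=> h1 h2; rewrite /adj /dist.
have l3 : 0 <= 3 * l by move: l0; lra.
rewrite -[C]gtr0_norm // -sqrtr_sqr ler_wsqrtr //.
have -> : C = 8 * l by rewrite /l; lra.
rewrite -real_normK ?num_real // -[X in _ + X]real_normK ?num_real //.
have a1 : `|(pos i).1 - (pos j).1| ^+ 2 <= (3 * l) ^+ 2 by rewrite ler_sqr ?nnegrE.
have a2 : `|(pos i).2 - (pos j).2| ^+ 2 <= (3 * l) ^+ 2 by rewrite ler_sqr ?nnegrE.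
by have := sqr_ge0 l; rewrite !exprMn in a1 a2 *; lra.
Qed.

(** Cells are taken with bounded indices to keep the predicate boolean; by [ncells_gt] every cell of
    the route is still included. *)
Let route_nodes i : pred 'I_n := fun t =>
  [|| t == i, t == dst i | [exists Q : 'I_(ncells rad l) * 'I_(ncells rad l),
    route_cells i (Q.1 : nat, Q.2 : nat) && (t == rep (Q.1 : nat, Q.2 : nat))]].

Let rep_route i Q : route_cells i Q -> rep Q \in route_nodes i.
Proof.
move=> iQ; have [Q1 Q2] := ncells_gt (route_full iQ).
change (is_true (route_nodes i (rep Q))); rewrite /route_nodes.
apply/or3P; apply: Or33; apply/existsP.
by exists (Ordinal Q1, Ordinal Q2) => /=; rewrite -surjective_pairing iQ eqxx.
Qed.

Let route_rel i : rel 'I_n :=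
  [rel a b | [&& adj a b, a \in route_nodes i & b \in route_nodes i]].

Let adjC : symmetric adj.
Proof. by move=> a b; rewrite /adj distC. Qed.

Let route_relC i : symmetric (route_rel i).
Proof. by move=> a b; rewrite /route_rel /= adjC; congr (_ && _); rewrite andbC. Qed.

Let cell_near x y a b : cell rad l a x -> cell rad l b y -> (a <= b.+1)%N -> (b <= a.+1)%N ->
  `|x - y| <= 3 * l.
Proof.
rewrite /cell /= !in_itv /= -!natr1 => /andP[x1 x2] /andP[y1 y2].
rewrite -!(ler_nat R) -!natr1 => ab ba; rewrite ler_norml.
have l0' := ltW l0.
have abl : a%:R * l <= (b%:R + 1) * l by rewrite ler_wpM2r.
have bal : b%:R * l <= (a%:R + 1) * l by rewrite ler_wpM2r.
by apply/andP; split; lra.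
Qed.

Let rep_near Q Q' : full Q -> full Q' ->
  (Q.1 <= Q'.1.+1)%N -> (Q'.1 <= Q.1.+1)%N -> (Q.2 <= Q'.2.+1)%N -> (Q'.2 <= Q.2.+1)%N ->
  adj (rep Q) (rep Q').
Proof.
move=> /repP[a1 a2] /repP[b1 b2] c1 c2 c3 c4.
by apply: near; [apply: cell_near a1 b1 _ _|apply: cell_near a2 b2 _ _].
Qed.

(** Contraction moves a coordinate by at most [(1 - s) * rad = 2 * l], and the relay of the home
    cell adds at most [l]. *)
Let home_near j : full (home j) -> adj j (rep (home j)).
Proof.
have [s0 s1] := s_bounds.
have aux x y : - rad <= x <= rad -> - rad <= s * x <= rad ->
    cell rad l (gd (s * x)) y -> `|x - y| <= 3 * l.
  move=> xr /andP[sx _]; have := cell_gidx l0 sx.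
  rewrite /cell /= !in_itv /= -natr1 => /andP[a1 a2] /andP[b1 b2].
  have h : `|x - s * x| <= 2 * l.
    rewrite -[X in X - _]mul1r -mulrBl normrM ger0_norm; last by move: s1; lra.
    apply: (@le_trans _ _ ((1 - s) * rad)); last by rewrite mulrBl srad; lra.
    by rewrite ler_wpM2l ?ler_norml //; lra.
  move: h; rewrite !ler_norml => /andP[h1 h2].
  by apply/andP; split; lra.
move=> /repP[h1 h2]; have [p1 p2] := pos_bounds j.
by apply: near; [apply: aux h1|apply: aux h2] => //;
  [apply: (coord_bounds (false, true) j)|apply: (coord_bounds (true, true) j)].
Qed.

Let home_src i : route_cells i (home i).
Proof.
by rewrite /route_cells; case: ifP => _; rewrite !eqxx betweenL.
Qed.

Let home_dst i : route_cells i (home (dst i)).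
Proof.
by rewrite /route_cells; case: ifP => _; rewrite !eqxx !betweenR orbT.
Qed.

Let between_S a b x : (minn a b <= x)%N -> (x < maxn a b)%N ->
  between a b x /\ between a b x.+1.
Proof.
move=> h1 h2; rewrite /between h1 (ltnW h2) h2; split=> //.
by rewrite andbT; apply: leq_trans h1 _.
Qed.

Let route_connect i : connect (route_rel i) i (dst i).
Proof.
have iN : i \in route_nodes i.
  by change (is_true (route_nodes i i)); rewrite /route_nodes eqxx.
have dN : dst i \in route_nodes i.
  by change (is_true (route_nodes i (dst i))); apply/or3P; apply: Or32.
have edge Q Q' : route_cells i Q -> route_cells i Q' ->
    (Q.1 <= Q'.1.+1)%N -> (Q'.1 <= Q.1.+1)%N ->
    (Q.2 <= Q'.2.+1)%N -> (Q'.2 <= Q.2.+1)%N ->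
    route_rel i (rep Q) (rep Q').
  move=> r r' *; rewrite /route_rel /= !rep_route // !andbT.
  by apply: rep_near => //; apply: route_full; eassumption.
have start : connect (route_rel i) i (rep (home i)).
  apply: connect1; rewrite /route_rel /= iN rep_route ?home_src // !andbT.
  exact: home_near (route_full (home_src i)).
have finish : connect (route_rel i) (rep (home (dst i))) (dst i).
  rewrite (sym_connect_sym (@route_relC i)).
  apply: connect1; rewrite /route_rel /= dN rep_route ?home_dst // !andbT.
  exact: home_near (route_full (home_dst i)).
apply: connect_trans start _; apply: connect_trans _ finish.
have horiz b : (forall x, between (home i).1 (home (dst i)).1 x -> route_cells i (x, b)) ->
    connect (route_rel i) (rep ((home i).1, b)) (rep ((home (dst i)).1, b)).
  move=> h; apply: (@connect_chain _ (route_rel i) (fun x => rep (x, b))).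
    exact: route_relC.
  by move=> x x1 x2; have [y1 y2] := between_S x1 x2;
    apply: edge; rewrite /= ?leqnSn ?leqnn //; try exact: h; lia.
have vert a : (forall y, between (home i).2 (home (dst i)).2 y -> route_cells i (a, y)) ->
    connect (route_rel i) (rep (a, (home i).2)) (rep (a, (home (dst i)).2)).
  move=> h; apply: (@connect_chain _ (route_rel i) (fun y => rep (a, y))).
    exact: route_relC.
  by move=> x x1 x2; have [y1 y2] := between_S x1 x2;
    apply: edge; rewrite /= ?leqnSn ?leqnn //; try exact: h; lia.
(* The two legs share the cell of the bend, so the chains of relays along them can be concatenated
   there. *)
have [c|c] := boolP (corner i).
  apply: connect_trans (horiz (home i).2 _) (vert (home (dst i)).1 _).
    by move=> x xb; rewrite /route_cells c /= eqxx xb.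
  by move=> y yb; rewrite /route_cells c /= eqxx yb orbT.
apply: connect_trans (vert (home i).1 _) (horiz (home (dst i)).2 _).
  by move=> y yb; rewrite /route_cells (negbTE c) /= eqxx yb.
by move=> x xb; rewrite /route_cells (negbTE c) /= eqxx xb orbT.
Qed.

Let route_exists i : exists p : seq 'I_n,
  [/\ p <> [::], path adj i p, last i p = dst i, uniq (i :: p) &
    {subset i :: p <= route_nodes i}].
Proof.
apply: connect_uniq_path (route_connect i); first by rewrite eq_sym.
by change (is_true (route_nodes i i)); rewrite /route_nodes eqxx.
Qed.

(** Within the cell [Q], a route can transmit only from its source, its destination or the relay of
    [Q]. The first two cases are counted by uncontracted slabs, with bounds [4 * q] and [32 * q];
    the third by four contracted slabs. The total is [3 * (4 + 32) = 108] times [q]. *)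
Let load_le (p : 'I_n -> seq 'I_n) Q :
  (forall i, {subset i :: p i <= route_nodes i}) ->
  (size (cell_hops p real_cell Q))%:R <= 108 * q.
Proof.
move=> pV.
pose A1 := [set i | real_cell i == Q]%SET.
pose A2 := [set i | real_cell (dst i) == Q]%SET.
pose A3 := [set i | route_cells i Q]%SET.
pose B (k : bool * bool) (a : nat) := [set i | gd (coord s k (pos i)) == a]%SET.
pose B' (k : bool * bool) (a : nat) := [set i | gd (coord s k (pos (dst i))) == a]%SET.
have cB k a : #|B k a|%:R <= 4 * q.
  by have [h _] := count_le k a; rewrite cardsE.
have cB' k a : #|B' k a|%:R <= 32 * q.
  by have [_ h] := count_le k a; rewrite cardsE.
have c1 : (#|A1| <= #|B (false, false) Q.1|)%N.
  apply: subset_leq_card; apply/fintype.subsetP => i; rewrite !inE /coord /= mul1r.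
  by move=> /eqP <-.
have c2 : (#|A2| <= #|B' (false, false) Q.1|)%N.
  apply: subset_leq_card; apply/fintype.subsetP => i; rewrite !inE /coord /= mul1r.
  by move=> /eqP <-.
(* On either shape of L, a leg through [Q] shares a row or a column with the home of the source or
   of the destination. *)
have c3 : (#|A3| <= #|B (true, true) Q.2| + #|B' (false, true) Q.1| +
                    (#|B (false, true) Q.1| + #|B' (true, true) Q.2|))%N.
  apply: leq_trans (leq_add (leq_card_setU _ _) (leq_card_setU _ _)).
  apply: leq_trans (leq_card_setU _ _).
  apply: subset_leq_card; apply/fintype.subsetP => i; rewrite !inE /coord /= /route_cells.
  by case: ifP => _ /orP[] /andP[/eqP-> _]; rewrite eqxx ?orbT.
have sz : (size (cell_hops p real_cell Q) <= #|A1| + #|A2| + #|A3|)%N.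
  have -> : size (cell_hops p real_cell Q) =
     #|[set x : 'I_n * 'I_n | (x.2 \in belast x.1 (p x.1)) && (real_cell x.2 == Q)]%SET|.
    by rewrite cardsE cardE /enum_mem /cell_hops size_filter enumT
      size_filter; apply: eq_count => x; rewrite inE.
  apply: (@leq_trans #|((fun i => (i, i)) @: A1) :|: ((fun i => (i, dst i)) @: A2) :|:
                       ((fun i => (i, rep Q)) @: A3)|%SET).
    apply: subset_leq_card; apply/fintype.subsetP => -[i t]; rewrite !inE /=.
    move=> /andP[tp /eqP tQ].
    have := pV i t (mem_belast tp).
    move=> tV; have {tV} : is_true (route_nodes i t) by exact: tV.
    move=> /or3P[/eqP ti|/eqP td|/existsP[[a b] /= /andP[r /eqP tr]]].
    - apply/orP; left; apply/orP; left; rewrite ti; apply: imset_f.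
      by rewrite inE -ti tQ.
    - apply/orP; left; apply/orP; right; rewrite td.
      by apply: (imset_f (fun i => (i, dst i))); rewrite inE -td tQ.
    (* A relay lies in the cell that it represents, so the route cell [(a, b)] is [Q] itself and the
       transmitter is [rep Q]. *)
    - apply/orP; right; have QE : Q = (val a, val b).
        by rewrite -tQ tr rep_cell //; apply: route_full r.
      by rewrite tr -QE; apply: (imset_f (fun i => (i, rep Q))); rewrite inE QE.
  apply: leq_trans (leq_card_setU _ _) _; apply: leq_add; last exact: leq_imset_card.
  apply: leq_trans (leq_card_setU _ _) _.
  by apply: leq_add; apply: leq_imset_card.
have {}sz := leq_trans sz (leq_add (leq_add c1 c2) c3).
move: sz; rewrite -(ler_nat R) !natrD => /le_trans; apply.
have := cB (false, false) Q.1; have := cB' (false, false) Q.1.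
have := cB (true, true) Q.2; have := cB' (false, true) Q.1.
have := cB (false, true) Q.1; have := cB' (true, true) Q.2.
lra.
Qed.

(** Adding 2 to the integer part gives [K - 1 >= 8 * (2 + D)]. Points of distinct cells congruent
    modulo [K] on an axis are at least [(K - 1) * l >= C * (2 + D)] apart. The upper bound
    [9 * (2 + D)] leaves room for the added 2 because [2 + D >= 2]. *)
Let K : nat := (Num.truncn (8 * (2 + D))).+2.
Let col (Q : nat * nat) : nat := ((Q.1 %% K) * K + Q.2 %% K)%N.

Let K_lo : 8 * (2 + D) + 1 <= K%:R.
Proof.
have := truncnS_gt (8 * (2 + D)); rewrite /K -[X in _ -> _ <= X]natr1; lra.
Qed.

Let K_hi : K%:R <= 9 * (2 + D).
Proof.
have h : (Num.truncn (8 * (2 + D)))%:R <= 8 * (2 + D).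
  by rewrite truncn_le; move: D0; lra.
by rewrite /K -natr1 -natr1; move: D0; lra.
Qed.

Let colK Q : (col Q < K * K)%N.
Proof.
have m1 : (Q.1 %% K < K)%N by rewrite ltn_mod.
have m2 : (Q.2 %% K < K)%N by rewrite ltn_mod.
by rewrite /col; apply: (@leq_trans ((Q.1 %% K).+1 * K)%N);
  [rewrite mulSn addnC ltn_add2r | rewrite leq_mul2r m1 orbT].
Qed.

Let col_inj Q Q' : col Q = col Q' -> Q.1 = Q'.1 %[mod K] /\ Q.2 = Q'.2 %[mod K].
Proof.
move=> e; split.
  have := congr1 (divn^~ K) e.
  by rewrite /col !divnMDl // !divn_small ?ltn_mod // !addn0.
by have := congr1 (modn^~ K) e; rewrite /col !modnMDl !modn_mod.
Qed.

Let cell_far x y a b : cell rad l a x -> cell rad l b y -> a = b %[mod K] -> a <> b ->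
  C * (2 + D) <= `|x - y|.
Proof.
wlog ab : x y a b / (a < b)%N.
  move=> h xa yb m /eqP; rewrite neq_ltn => /orP[ab|ba].
    by apply: (h _ _ a b) => //; apply/eqP; rewrite ltn_eqF.
  by rewrite distrC; apply: (h _ _ b a) => //; apply/eqP; rewrite ltn_eqF.
move=> xa yb m _.
have kab : (a + K <= b)%N.
  have : (b == a %[mod K])%N by rewrite m.
  rewrite eqn_mod_dvd ?(ltnW ab) // => /dvdn_leq.
  by rewrite subn_gt0 ab => /(_ isT); lia.
move: xa yb; rewrite /cell /= !in_itv /= -natr1 => /andP[_ x2] /andP[y1 _].
have kabl : (a%:R + K%:R) * l <= b%:R * l by rewrite ler_pM2r // -natrD ler_nat.
have Kl : (8 * (2 + D) + 1) * l <= K%:R * l by rewrite ler_pM2r.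
rewrite distrC; apply: le_trans (ler_norm _).
have -> : C = 8 * l by rewrite /l; lra.
lra.
Qed.

(** Distinct cells differ in some coordinate, and the distance dominates each coordinate
    difference. *)
Let cells_far t t' : real_cell t <> real_cell t' ->
  col (real_cell t) = col (real_cell t') -> C * (2 + D) <= dist (pos t) (pos t').
Proof.
move=> ne /col_inj /= [m1 m2].
have [/andP[p1 _] /andP[p2 _]] := pos_bounds t.
have [/andP[p1' _] /andP[p2' _]] := pos_bounds t'.
have [e1|/eqP e1] := eqVneq (gd (pos t).1) (gd (pos t').1).
  have e2 : gd (pos t).2 <> gd (pos t').2.
    by move=> e2; apply: ne; rewrite /real_cell e1 e2.
  apply: le_trans (cell_far (cell_gidx l0 p2) (cell_gidx l0 p2') m2 e2) _.
  by rewrite -sqrtr_sqr ler_wsqrtr // lerDr sqr_ge0.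
apply: le_trans (cell_far (cell_gidx l0 p1) (cell_gidx l0 p1') m1 e1) _.
by rewrite -sqrtr_sqr ler_wsqrtr // lerDl sqr_ge0.
Qed.

(** There are [K * K] colours, each round has that many slots, and the number of rounds is the
    integer part of the load bound [108 * q]; finally [K ^ 2 <= 81 * (2 + D) ^ 2]. *)
Lemma typical_good_system : exists sys : 'I_n -> seq (shop n),
  [/\ is_system dst sys, DC_successful C D pos sys &
      (period sys)%:R <= 81 * (2 + D) ^+ 2 * (108 * q)].
Proof.
have [p pP] := choice route_exists.
have p0 i : p i <> [::] by case: (pP i).
have pl i : last i (p i) = dst i by case: (pP i).
have pu i : uniq (i :: p i) by case: (pP i).
have pV i : {subset i :: p i <= route_nodes i} by case: (pP i).
have q0 : 0 <= 108 * q by apply: le_trans (load_le (0%N, 0%N) pV).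
pose L := Num.truncn (108 * q).
have loadL Q : (size (cell_hops p real_cell Q) <= L)%N.
  by rewrite /L truncn_ge_nat // load_le.
exists (scheduled p real_cell col (K * K)); split.
- exact: scheduled_system.
- move=> x /mem_scheduled[i xz [xt xs]]; split.
    by apply: (@path_zip_rel _ adj i (p i)); [case: (pP i)|rewrite -surjective_pairing].
  (* The distinguished transmitter and its competitors alike are transmitters of the slot [x.2]. *)
  have tx u : ((u <> pos x.1.1 /\ exists2 z, z \in all_hops (scheduled p real_cell col (K * K)) &
       z.2 = x.2 /\ pos z.1.1 = u) \/ u = pos x.1.1) ->
     exists j t, [/\ t \in belast j (p j), hop_slot p real_cell col (K * K) (j, t) = x.2 &
       pos t = u].
    case=> [[_ [z /mem_scheduled[j _ [zt zs]] [zx zu]]]|->].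
      by exists j, z.1.1; split; rewrite -?zs.
    by exists i, x.1.1; split.
  move=> u v /tx[j [t [tj ts <-]]] /tx[j' [t' [tj' ts' <-]]] ne.
  have [colE inj] := @hop_slot_inj _ p _ real_cell col (K * K) colK (j, t) (j', t') tj tj'
    (etrans ts (esym ts')).
  (* Equal slots give equal colours; a common cell would make the two hops equal, against the
     distinct positions. *)
  by apply: cells_far => // e; have [_ te] := inj e; apply: ne; rewrite te.
apply: (@le_trans _ _ ((K * K * L)%N)%:R).
  by rewrite ler_nat; apply: scheduled_period.
rewrite !natrM; apply: ler_pM; rewrite ?mulr_ge0 //; last by rewrite truncn_le.
have -> : 81 * (2 + D) ^+ 2 = (9 * (2 + D)) * (9 * (2 + D)) by ring.
by apply: ler_pM.
Qed.

End Routing.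

(** * Probability of slabs and of cells *)

Section UnifDisk.
Variable R : realType.
Implicit Types (rad l s a b c d : R) (A : set (pt2 R)).

Lemma leb2_rect (I J : interval R) :
  leb2 ([set` I] `*` [set` J]) = (lebesgue_measure [set` I] * lebesgue_measure [set` J])%E.
Proof. by rewrite /leb2 product_measure1E. Qed.

Lemma unif_disk_le rad A a b c d : 0 < rad -> measurable A -> a <= b -> c <= d ->
  A `&` disk rad `<=` [set` `[a, b]] `*` [set` `[c, d]] ->
  unif_disk rad A <= (b - a) * (d - c) / (pi * rad ^+ 2).
Proof.
move=> r0 mA ab cd sub.
have : (leb2 (A `&` disk rad) <= ((b - a) * (d - c))%:E)%E.
  apply: (@le_trans _ _ (leb2 ([set` `[a, b]] `*` [set` `[c, d]]))).
    apply: le_measure => //; rewrite inE.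
      by apply: measurableI => //; apply: measurable_disk.
    exact: measurableX.
  rewrite leb2_rect !lebesgue_measure_itv /= !lte_fin.
  have len x y : x <= y -> (if x < y then (y%:E - x%:E)%E else 0%E) = (y - x)%:E :> \bar R.
    by rewrite le_eqVlt => /orP[/eqP->|->]; rewrite ?ltxx ?subrr.
  by rewrite !len // EFinM.
have : (0 <= leb2 (A `&` disk rad))%E by exact: measure_ge0.
rewrite /unif_disk; case: (leb2 _) => [x| |] //=; rewrite lee_fin => _ h.
by rewrite ler_pM2r // invr_gt0 mulr_gt0 ?pi_gt0 ?exprn_gt0.
Qed.

Lemma unif_disk_ge rad A a b c d : 0 < rad -> measurable A -> a < b -> c < d ->
  [set` `[a, b[] `*` [set` `[c, d[] `<=` A `&` disk rad ->
  (b - a) * (d - c) / (pi * rad ^+ 2) <= unif_disk rad A.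
Proof.
move=> r0 mA ab cd sub.
have : (((b - a) * (d - c))%:E <= leb2 (A `&` disk rad))%E.
  apply: (@le_trans _ _ (leb2 ([set` `[a, b[] `*` [set` `[c, d[]))).
    by rewrite leb2_rect !lebesgue_measure_itv /= !lte_fin ab cd.
  apply: le_measure => //; rewrite inE; first exact: measurableX.
  by apply: measurableI => //; apply: measurable_disk.
(* Finiteness is required before [fine] can be compared; the square around the disk provides it. *)
have : (leb2 (A `&` disk rad) <= ((rad + rad) * (rad + rad))%:E)%E.
  apply: (@le_trans _ _ (leb2 ([set` `[- rad, rad]] `*` [set` `[- rad, rad]]))).
    apply: le_measure => //; rewrite ?inE.
    - by apply: measurableI => //; apply: measurable_disk.
    - exact: measurableX.
    - by move=> p [_ /(disk_coord (ltW r0))[h1 h2]]; split; rewrite /= in_itv.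
  rewrite leb2_rect !lebesgue_measure_itv /= !lte_fin.
  by rewrite gtrN // opprK.
rewrite /unif_disk; case: (leb2 _) => [x| |] //=; rewrite !lee_fin => _ h.
by rewrite ler_pM2r // invr_gt0 mulr_gt0 ?pi_gt0 ?exprn_gt0.
Qed.

Lemma measurable_box rad l i j : measurable (box rad l i j).
Proof. by apply: measurableX; apply: measurable_itv. Qed.

Lemma measurable_slab rad l s k i : measurable (slab rad l s k i).
Proof.
rewrite -[slab _ _ _ _ _]setTI; apply: (_ : measurable_fun setT (coord s k)) => //.
  by apply: measurable_funM => //; case: k => [[] ?] /=;
    [apply: measurable_snd|apply: measurable_fst].
exact: measurable_itv.
Qed.

(** As the contraction factor is at least one half, the slab has width at most [2 * l]; inside the
    disk its length is at most [2 * rad]. *)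
Lemma unif_disk_slab rad l s k i : 0 < rad -> 0 < l -> 2^-1 <= s -> s <= 1 ->
  unif_disk rad (slab rad l s k i) <= 4 * l / (pi * rad).
Proof.
move=> r0 l0 s_ge s_le.
pose c : R := if k.2 then s else 1.
have [c_ge c_le] : 2^-1 <= c /\ c <= 1 by rewrite /c; case: k.2; split; lra.
have c0 : 0 < c by lra.
pose lo := (i%:R * l - rad) / c; pose hi := (i.+1%:R * l - rad) / c.
have lohi : hi - lo <= 2 * l.
  rewrite /hi /lo -mulrBl ler_pdivrMr // -natr1.
  have : 0 <= l * (2 * c - 1) by rewrite mulr_ge0 ?(ltW l0) //; lra.
  lra.
have lohi0 : lo <= hi.
  rewrite /lo /hi ler_pM2r ?invr_gt0 // -natr1; lra.
have bound x : cell rad l i (c * x) -> lo <= x <= hi.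
  rewrite /cell /= in_itv /= => /andP[h1 h2].
  by rewrite /lo /hi ler_pdivrMr // ler_pdivlMr // ![x * c]mulrC h1 ltW.
have rr : - rad <= rad by lra.
have fin x : x <= (hi - lo) * (rad - - rad) / (pi * rad ^+ 2) -> x <= 4 * l / (pi * rad).
  move/le_trans; apply.
  have -> : 4 * l / (pi * rad) = (2 * l) * (rad - - rad) / (pi * rad ^+ 2).
    have pi0 : pi != 0 :> R by rewrite gt_eqF ?pi_gt0.
    have rad0 : rad != 0 by rewrite gt_eqF.
    by move: pi0; move: (@pi R) => P P0; field; rewrite P0 rad0.
  by rewrite ler_pM2r ?invr_gt0 ?mulr_gt0 ?pi_gt0 ?exprn_gt0 // ler_wpM2r //; lra.
apply: fin; have mS := measurable_slab rad l s k i.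
have bS p : slab rad l s k i p -> lo <= (if k.1 then p.2 else p.1) <= hi by apply: bound.
case: k.1 bS => bS.
  rewrite [(hi - lo) * _]mulrC.
  apply: unif_disk_le => // p [pS /(disk_coord (ltW r0))[h1 h2]].
  by split; rewrite /= in_itv //=; apply: bS.
apply: unif_disk_le => // p [pS /(disk_coord (ltW r0))[h1 h2]].
by split; rewrite /= in_itv //=; apply: bS.
Qed.

Lemma unif_disk_box rad l i j : 0 < rad -> 0 < l -> box rad l i j `<=` disk rad ->
  l ^+ 2 / (pi * rad ^+ 2) <= unif_disk rad (box rad l i j).
Proof.
move=> r0 l0 sub.
have e (k : nat) : (k.+1%:R * l - rad) - (k%:R * l - rad) = l by rewrite -natr1; ring.
have lt (k : nat) : k%:R * l - rad < k.+1%:R * l - rad by rewrite -natr1; lra.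
have := unif_disk_ge r0 (measurable_box rad l i j) (lt i) (lt j).
by rewrite !e; apply=> p pB; split=> //; apply: sub.
Qed.

End UnifDisk.

(** A union bound over empty boxes and crowded slabs, besides two null events. With at most
    [17 / rho] indices per axis there are at most [289 / rho ^ 2] boxes, each of probability at
    least [rho ^ 2 / (64 * pi)] when inside the disk. The factor 136 is [2 * 4 * 17]: two Chernoff
    bounds for each of the four kinds of slab. *)
Lemma atypical_bound (R : realType) (d : measure_display) (Omega : measurableType d)
    (P : probability Omega R) (n : nat) (rad C : R)
    (pos : 'I_n -> Omega -> pt2 R) (dst : 'I_n -> Omega -> 'I_n) :
  (2 <= n)%N -> random_SD_set P rad pos dst -> 0 < C -> C < rad / 2 ->
  let rho := C / rad in
  exists B : set Omega, [/\ measurable B,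
    forall w, ~ B w ->
      typical rad (C / 8) (1 - 2 * (C / 8) / rad) (n%:R * rho) (pos^~ w) (dst^~ w) /\
      (forall i, dst i w != i) &
    (P B <= (289 / rho ^+ 2 * expR (- (n%:R * (rho ^+ 2 / (64 * pi)))) +
             136 / rho * expR (- (n%:R * rho)))%:E)%E].
Proof.
move=> n2 SD C0 Crad rho.
set l := C / 8; set s := 1 - 2 * l / rad.
have r0 : 0 < rad by lra.
have l0 : 0 < l by rewrite /l; lra.
have rho0 : 0 < rho by rewrite /rho divr_gt0.
have rho_lt : rho < 1 / 2 by rewrite /rho ltr_pdivrMr //; lra.
have CE : C = rho * rad by rewrite /rho mulfVK // gt_eqF.
have sE : s = 1 - rho / 4 by rewrite /s /l /rho; field; rewrite gt_eqF.
set N := ncells rad l.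
(* Here [2 * rad / l = 16 / rho], and the extra cell costs at most [1 / rho] since [rho < 1]. *)
have N_le : N%:R <= 17 / rho.
  rewrite ler_pdivlMr // /N /ncells -natr1 mulrDl mul1r.
  have h : (Num.truncn (2 * rad / l))%:R <= 2 * rad / l.
    by rewrite truncn_le divr_ge0 ?(ltW l0) //; lra.
  have : (Num.truncn (2 * rad / l))%:R * rho <= 2 * rad / l * rho by rewrite ler_wpM2r // ltW.
  have -> : 2 * rad / l * rho = 16.
    by rewrite /l /rho; field; rewrite !gt_eqF.
  by lra.
have uD : unif_disk rad (disk rad) = 1.
  by have := unif_diskT n2 SD; rewrite /unif_disk setTI setIid.
have [mB0 PB0] := SD_outside n2 SD (measurable_disk rad) uD.
set B0 := [set w | _] in mB0 PB0.
have [mB3 PB3] := SD_dst_neq SD.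
set B3 := [set w | _] in mB3 PB3.
pose F1 (Q : 'I_N * 'I_N) : set Omega :=
  if `[< box rad l Q.1 Q.2 `<=` disk rad >]
  then [set w | [forall i, pos i w \notin box rad l Q.1 Q.2]] else set0.
have F1P Q : measurable (F1 Q) /\
    (P (F1 Q) <= (expR (- (n%:R * (rho ^+ 2 / (64 * pi)))))%:E)%E.
  rewrite /F1; case: ifP => [/asboolP sub|_]; last first.
    by split=> //; rewrite measure0 lee_fin expR_ge0.
  have [m h] := SD_void n2 SD (measurable_box rad l Q.1 Q.2); split=> //.
  apply: le_trans h _; rewrite lee_fin ler_expR lerN2 ler_wpM2l //.
  apply: le_trans (unif_disk_box r0 l0 sub).
  rewrite (_ : rho ^+ 2 / _ = l ^+ 2 / (pi * rad ^+ 2)) // /l /rho.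
  have : pi != 0 :> R by rewrite gt_eqF ?pi_gt0.
  by move: (@pi R) => p p0; field; rewrite p0 gt_eqF.
pose F2 (x : (bool * bool) * 'I_N) : set Omega :=
  [set w | (4 * (n%:R * rho) < #|[pred i | pos i w \in slab rad l s x.1 x.2]|%:R) ||
           (32 * (n%:R * rho) < #|[pred i | pos (dst i w) w \in slab rad l s x.1 x.2]|%:R)].
have F2P x : measurable (F2 x) /\ (P (F2 x) <= (2 * expR (- (n%:R * rho)))%:E)%E.
  apply: (SD_crowd n2 SD (measurable_slab rad l s x.1 x.2)); last exact: ltW.
  apply: (le_trans (unif_disk_slab _ _ r0 l0 _ _)); [by rewrite sE; lra|by rewrite sE; lra|].
  rewrite ler_pdivrMr ?mulr_gt0 ?pi_gt0 // /l CE.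
  have : 2 * (rho * rad) <= pi * (rho * rad) by rewrite ler_wpM2r ?pi_ge2 // ltW // mulr_gt0.
  have : 0 < rho * rad by rewrite mulr_gt0.
  lra.
have mF1 Q : measurable (F1 Q) by case: (F1P Q).
have mF2 x : measurable (F2 x) by case: (F2P x).
have mU1 : measurable (\bigcup_Q F1 Q) by apply: fin_bigcup_measurable => //; exact: finite_finset.
have mU2 : measurable (\bigcup_x F2 x) by apply: fin_bigcup_measurable => //; exact: finite_finset.
have mU : measurable (\bigcup_Q F1 Q `|` \bigcup_x F2 x) by apply: measurableU.
exists (B3 `|` (B0 `|` (\bigcup_Q F1 Q `|` \bigcup_x F2 x))); split.
- by apply: measurableU => //; apply: measurableU.
- move=> w /not_orP[nB3 /not_orP[nB0 /not_orP[nU1 nU2]]]; split; last first.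
    by move: nB3; rewrite /B3 /= => /negP/negPn /forallP.
  split.
  + move: nB0; rewrite /B0 /= => /negP/negPn /forallP h i.
    by have := h i; rewrite inE.
  + move=> a b aN bN sub; apply: contrapT => nex; apply: nU1.
    exists (Ordinal aN, Ordinal bN) => //; rewrite /F1 /= ifT; last exact/asboolP.
    by apply/forallP => i; apply/negP; rewrite inE => h; apply: nex; exists i.
  move=> k a aN; have : ~ F2 (k, Ordinal aN) w by move=> h; apply: nU2; exists (k, Ordinal aN).
  by rewrite /F2 /= => /negP; rewrite negb_or -!leNgt => /andP[].
apply: (le_trans (measureU2 _ _ _)) => //; first exact: measurableU.
rewrite [X in (X + _)%E]PB3 add0e.
apply: (le_trans (measureU2 _ _ _)) => //.
rewrite [X in (X + _)%E]PB0 add0e.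
apply: (le_trans (measureU2 _ _ _)) => //.
rewrite EFinD; apply: leeD.
  apply: (le_trans (measure_bigsetU_le _ mF1)).
  apply: (@le_trans _ _ (\sum_(Q : 'I_N * 'I_N) (expR (- (n%:R * (rho ^+ 2 / (64 * pi)))))%:E)%E).
    by apply: lee_sum => Q _; case: (F1P Q).
  rewrite sumEFin lee_fin sumr_const card_prod card_ord -[leLHS]mulr_natl.
  rewrite ler_wpM2r ?expR_ge0 // natrM.
  have -> : 289 / rho ^+ 2 = (17 / rho) * (17 / rho) by field; rewrite gt_eqF.
  by apply: ler_pM.
apply: (le_trans (measure_bigsetU_le _ mF2)).
apply: (@le_trans _ _ (\sum_(x : (bool * bool) * 'I_N) (2 * expR (- (n%:R * rho)))%:E)%E).
  by apply: lee_sum => x _; case: (F2P x).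
rewrite sumEFin lee_fin sumr_const !card_prod card_bool card_ord -[leLHS]mulr_natl mulrA.
rewrite ler_wpM2r ?expR_ge0 // !natrM.
have -> : 136 / rho = 2 * 2 * (17 / rho) * 2 by field; rewrite gt_eqF.
lra.
Qed.

(** * Asymptotics and measurability *)

(** The factor [ln (expR 1 / 2)] is at most [ln (expR 1) = 1]. *)
Lemma const_a_le (R : realType) : const_a R <= (2 ^+ 13 * pi)^-1.
Proof.
rewrite /const_a ler_piMr ?invr_ge0 ?mulr_ge0 ?exprn_ge0 ?pi_ge0 //.
have e0 := expR_gt0 (1 : R).
rewrite -[leRHS](expRK 1) ler_ln ?posrE ?divr_gt0 //.
by rewrite ler_pdivrMr //; lra.
Qed.

(** The exponents are [128 * y] and at least [y], where [y >= x - ln rho >= 0]. Hence the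
    exponentials are at most [rho ^ 2 * expR (- x)] and [rho * expR (- x)], and these powers of
    [rho] cancel the numbers of boxes and slabs; [425 = 289 + 136]. *)
Lemma atypical_tail (R : realType) (n : nat) (rho : R) :
  0 < rho -> rho < 2^-1 ->
  let x := const_a R * n%:R * rho ^+ 2 + ln rho in
  0 <= x ->
  289 / rho ^+ 2 * expR (- (n%:R * (rho ^+ 2 / (64 * pi)))) +
    136 / rho * expR (- (n%:R * rho)) <= 425 * expR (- x).
Proof.
move=> rho0 rho_lt x x0.
pose y : R := n%:R * rho ^+ 2 / (2 ^+ 13 * pi).
have pi2 := pi_ge2 R; have pi0 := pi_gt0 R.
have d0 : 0 < 2 ^+ 13 * pi :> R by rewrite mulr_gt0 ?exprn_gt0.
have nr0 : 0 <= n%:R * rho ^+ 2 by rewrite mulr_ge0 ?sqr_ge0.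
have lnr : ln rho <= 0 by rewrite ln_le0 //; lra.
have xy : x - ln rho <= y.
  rewrite /x addrK -mulrA /y [leRHS]mulrC; apply: ler_wpM2r => //.
  exact: const_a_le.
have -> : n%:R * (rho ^+ 2 / (64 * pi)) = 128 * y.
  rewrite /y; have : pi != 0 :> R by rewrite gt_eqF.
  by move: (@pi R) => p p0; field.
have yn : y <= n%:R * rho.
  rewrite /y ler_pdivrMr // expr2 mulrA ler_wpM2l ?mulr_ge0 // ?(ltW rho0) //.
  have : 1 <= 2 ^+ 13 :> R by rewrite exprn_ege1 //; lra.
  nra.
have rhoE : expR (ln rho) = rho by apply: lnK; rewrite posrE.
have h1 : expR (- (n%:R * rho)) <= expR (- x) * rho.
  by rewrite -{2}rhoE -expRD ler_expR; lra.
have h2 : expR (- (128 * y)) <= expR (- x) * rho ^+ 2.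
  rewrite -{1}rhoE expr2 -!expRD ler_expR; lra.
have -> : 425 * expR (- x) =
    289 / rho ^+ 2 * (expR (- x) * rho ^+ 2) + 136 / rho * (expR (- x) * rho).
  by field; rewrite gt_eqF.
apply: lerD; apply: ler_wpM2l => //; rewrite divr_ge0 ?sqr_ge0 ?(ltW rho0) //.
Qed.

Lemma dist_le0 (R : realType) (p q : pt2 R) : (dist p q <= 0) = (p == q).
Proof.
rewrite /dist -[LHS]andbT -(sqrtr_ge0 ((p.1 - q.1) ^+ 2 + (p.2 - q.2) ^+ 2)) -eq_le sqrtr_eq0.
apply/idP/eqP => [h|->]; last by rewrite !subrr expr0n addr0.
have h1 := sqr_ge0 (p.1 - q.1); have h2 := sqr_ge0 (p.2 - q.2).
have e1 : (p.1 - q.1) ^+ 2 = 0 by lra.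
have e2 : (p.2 - q.2) ^+ 2 = 0 by lra.
move/eqP: e1 e2; rewrite sqrf_eq0 subr_eq0 => /eqP e1 /eqP; rewrite sqrf_eq0 subr_eq0 => /eqP e2.
by rewrite (surjective_pairing p) e1 e2 -surjective_pairing.
Qed.

(** For a fixed system the points in [DC] are positions of transmitters of finitely many hops, so
    the event is a finite intersection of distance conditions. Coinciding positions are exempt,
    which distance at most 0 expresses. *)
Lemma measurable_DC_successful (R : realType) (d : measure_display)
    (T : measurableType d) (n : nat) (C D : R) (pos : 'I_n -> T -> pt2 R)
    (sys : 'I_n -> seq (shop n)) :
  (forall i, measurable_fun setT (pos i)) ->
  measurable [set w | DC_successful C D (pos^~ w) sys].
Proof.
move=> mpos.
pose dle i j c := [set w | dist (pos i w) (pos j w) <= c].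
pose dge i j c := [set w | c <= dist (pos i w) (pos j w)].
have mdle i j c : measurable (dle i j c).
  have -> : dle i j c = (fun w => dist (pos i w) (pos j w)) @^-1` `]-oo, c].
    by apply/seteqP; split=> w /=; rewrite in_itv.
  by rewrite -[X in measurable X]setTI; apply: measurable_dist.
have mdge i j c : measurable (dge i j c).
  have -> : dge i j c = (fun w => dist (pos i w) (pos j w)) @^-1` `[c, +oo[.
    by apply/seteqP; split=> w /=; rewrite in_itv /= andbT.
  by rewrite -[X in measurable X]setTI; apply: measurable_dist.
pose H := all_hops sys.
have -> : [set w | DC_successful C D (pos^~ w) sys] =
    \bigcap_(x in [set` H]) (dle x.1.1 x.1.2 C `&`
      \bigcap_(y in [set` [seq y <- H | y.2 == x.2]])
      \bigcap_(z in [set` [seq z <- H | z.2 == x.2]])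
        (dle y.1.1 z.1.1 0 `|` dge y.1.1 z.1.1 (C * (2 + D)))).
  apply/seteqP; split=> w /= h x xH.
    have [h1 h2] := h x xH; split=> //= y; rewrite /= mem_filter => /andP[/eqP yx yH].
    move=> z /=; rewrite mem_filter => /andP[/eqP zx zH].
    have [e|ne] := eqVneq (pos y.1.1 w) (pos z.1.1 w).
      by left; rewrite /dle /= dist_le0 e.
    right; apply: h2; last exact/eqP.
      have [e|/eqP e] := eqVneq (pos y.1.1 w) (pos x.1.1 w); [by right|left].
      by split=> //; exists y.
    have [e|/eqP e] := eqVneq (pos z.1.1 w) (pos x.1.1 w); [by right|left].
    by split=> //; exists z.
  have [h1 h2] := h x xH; split=> // u v hu hv uv.
  have hop a : (a <> pos x.1.1 w /\
       (exists2 z, z \in all_hops sys & z.2 = x.2 /\ pos z.1.1 w = a)) \/ a = pos x.1.1 w ->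
     exists2 y, y \in [seq y <- H | y.2 == x.2] & pos y.1.1 w = a.
    case=> [[_ [z zH [zx za]]]|->].
      by exists z => //; rewrite mem_filter zx eqxx.
    by exists x => //; rewrite mem_filter eqxx.
  have [y yH yu] := hop u hu; have [z zH zv] := hop v hv.
  have [] := h2 y yH z zH; rewrite /dle /dge /= yu zv //.
  by rewrite dist_le0 => /eqP.
apply: fin_bigcap_measurable => [|x _]; first exact: finite_seq.
apply: measurableI => //.
apply: fin_bigcap_measurable => [|y _]; first exact: finite_seq.
apply: fin_bigcap_measurable => [|z _]; first exact: finite_seq.
exact: measurableU.
Qed.

(* The fallback when no good system exists. *)
Definition direct n (dest : 'I_n -> 'I_n) (i : 'I_n) : seq (shop n) :=
  [:: (i, dest i, i.+1)].

Lemma direct_system n (dest : 'I_n -> 'I_n) :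
  (forall i, dest i != i) -> is_system dest (direct dest).
Proof.
move=> dN; split=> [i|]; first by split=> //=; split=> //; rewrite inE eq_sym dN.
rewrite /compatible /all_hops.
have -> : flatten [seq direct dest i | i <- enum 'I_n] =
   [seq (i, dest i, i.+1) | i : 'I_n <- enum 'I_n].
  by elim: (enum _) => //= i e ->.
rewrite -map_comp map_inj_uniq ?enum_uniq // => i j /= [].
by [].
Qed.

Lemma period_gt0 n (dest : 'I_n -> 'I_n) (sys : 'I_n -> seq (shop n)) :
  (0 < n)%N -> is_system dest sys -> (0 < period sys)%N.
Proof.
move=> n0 [sysP _]; have [ne [_ [_ pos]]] := sysP (Ordinal n0).
case E : (sys (Ordinal n0)) ne pos => [//|x r] _ /= /andP[x0 _].
have xH : x \in all_hops sys.
  by apply/flatten_mapP; exists (Ordinal n0); rewrite ?mem_enum // E mem_head.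
apply: leq_trans x0 _; rewrite /period.
elim: (all_hops sys) xH => //= y s IH; rewrite inE leq_max => /orP[/eqP->|/IH ->];
  by rewrite ?leqnn ?orbT.
Qed.

(** * Selecting one system for each configuration *)

Section System.
Variables (R : realType) (n : nat) (C D B : R).

Definition good_system (pos : 'I_n -> pt2 R) (dest : 'I_n -> 'I_n)
    (sys : 'I_n -> seq (shop n)) : Prop :=
  [/\ is_system dest sys, DC_successful C D pos sys & (period sys)%:R <= B].

(** The choice sees only the positions and the destinations, and [B] bounds the period rather than
    the throughput, so one choice serves all probability spaces and packet sizes. *)
Definition best_system (pos : 'I_n -> pt2 R) (dest : 'I_n -> 'I_n) :
    'I_n -> seq (shop n) :=
  if pselect (exists sys, good_system pos dest sys) is left h
  then projT1 (cid h) else direct dest.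

Lemma best_system_good pos dest :
  (exists sys, good_system pos dest sys) -> good_system pos dest (best_system pos dest).
Proof.
by move=> h; rewrite /best_system; case: pselect => // h'; case: (cid h').
Qed.

Lemma best_system_direct pos dest :
  ~ (exists sys, good_system pos dest sys) -> best_system pos dest = direct dest.
Proof. by move=> h; rewrite /best_system; case: pselect. Qed.

Lemma best_system_valid pos dest :
  (forall i, dest i != i) -> is_system dest (best_system pos dest).
Proof.
move=> dN; have [/best_system_good[]//|h] := pselect (exists sys, good_system pos dest sys).
by rewrite best_system_direct //; exact: direct_system.
Qed.

(* [best_system] itself need not depend measurably on the positions; a property
   shared by all good systems only sees whether a good system exists. *)
Lemma measurable_best_system (d : measure_display) (T : measurableType d)
    (pos : 'I_n -> T -> pt2 R) (dst : 'I_n -> T -> 'I_n)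
    (Q : ('I_n -> pt2 R) -> ('I_n -> seq (shop n)) -> Prop) :
  (forall i, measurable_fun setT (pos i)) ->
  (forall i k, measurable (dst i @^-1` [set k])) ->
  (forall p k sys, good_system p k sys -> Q p sys) ->
  (forall sys, measurable [set w | Q (pos^~ w) sys]) ->
  measurable [set w | Q (pos^~ w) (best_system (pos^~ w) (dst^~ w))].
Proof.
move=> mpos mdst goodQ mQ.
(* Decomposition over the finitely many destination maps: [Q] holds if and only if some good system
   exists or the fallback satisfies [Q]. There are only countably many systems. *)
have -> : [set w | Q (pos^~ w) (best_system (pos^~ w) (dst^~ w))] =
  \bigcup_(k : {ffun 'I_n -> 'I_n}) ((\bigcap_i (dst i @^-1` [set k i])) `&`
     ((\bigcup_(sys : {ffun 'I_n -> seq (shop n)}) [set w | good_system (pos^~ w) k sys]) `|`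
      [set w | Q (pos^~ w) (direct k)])).
  apply/seteqP; split=> w /=.
    move=> h; exists [ffun i => dst i w] => //.
    have kE : dst^~ w = [ffun i => dst i w] by apply/funext => i; rewrite ffunE.
    split; first by move=> i _ /=; rewrite ffunE.
    rewrite -kE; have [[sys hs]|ng] := pselect (exists sys, good_system (pos^~ w) (dst^~ w) sys).
      left; exists (finfun sys) => //=.
      by rewrite (_ : (finfun sys : _ -> _) = sys) //; apply/funext => i; rewrite ffunE.
    by right; rewrite best_system_direct in h.
  move=> [k _ [kE h]].
  have -> : dst^~ w = k by apply/funext => i; apply: kE.
  have [ex|ng] := pselect (exists sys, good_system (pos^~ w) k sys).
    exact: goodQ (best_system_good ex).
  rewrite best_system_direct //; case: h => // -[sys _ hs].
  by case: ng; exists sys.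
apply: countable_bigcupT_measurable => // k; apply: measurableI.
  by apply: fin_bigcap_measurable => [|i _]; [exact: finite_finset|].
apply: measurableU => //; apply: countable_bigcupT_measurable => [|sys].
  exact: (@countableP {ffun 'I_n -> seq ('I_n * 'I_n * nat)}).
(* For fixed [k] and [sys], validity and period do not depend on [w]; the event is that of success,
   or empty. *)
have [h|h] := pselect (is_system k sys /\ (period sys)%:R <= B).
  rewrite (_ : mkset _ = [set w | DC_successful C D (pos^~ w) sys]).
    exact: measurable_DC_successful.
  by case: h => h1 h2; apply/seteqP; split=> w /=; [case|split].
rewrite (_ : mkset _ = set0) //.
by apply/seteqP; split=> w //= [h1 _ h2]; apply: h.
Qed.

End System.

(** * Convergence of both probabilities to 1 *)

Theorem theorem2 (R : realType) (gamma : R) (C : nat -> R) :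
  0 <= gamma ->
  (forall n, 0 < C n) ->
  (\forall n \near \oo, C n / n%:R `^ gamma < 2^-1) ->
  (fun n => const_a R * n%:R * (C n / n%:R `^ gamma) ^+ 2
            + ln (C n / n%:R `^ gamma)) @ \oo --> +oo ->
  forall D : nat -> R, (forall n, 0 < D n) ->
  exists S : forall n : nat, ('I_n -> pt2 R) -> ('I_n -> 'I_n) ->
                             ('I_n -> seq (shop n)),
    (forall n (pos : 'I_n -> pt2 R) (dest : 'I_n -> 'I_n),
       (forall i, dest i != i) -> is_system dest (S n pos dest)) /\
    forall (dO : measure_display) (Omega : measurableType dO)
           (P : probability Omega R)
           (pos : forall n, 'I_n -> Omega -> pt2 R)
           (dst : forall n, 'I_n -> Omega -> 'I_n),
      (forall n, (2 <= n)%N -> random_SD_set P (n%:R `^ gamma) (pos n) (dst n)) ->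
      forall W : R, 0 < W ->
        let cfg n w := S n (fun i => pos n i w) (fun i => dst n i w) in
        let Esucc n := [set w | DC_successful (C n) (D n) (fun i => pos n i w) (cfg n w)] in
        let Ethr n := [set w | W / (const_c R * n%:R `^ (1 - gamma) * C n * (2 + D n) ^+ 2)
                               <= throughput W (cfg n w)] in
        (forall n, (2 <= n)%N -> measurable (Esucc n) /\ measurable (Ethr n)) /\
        (fun n => P (Esucc n)) @ \oo --> 1%E /\
        (fun n => P (Ethr n)) @ \oo --> 1%E.
Proof.
move=> gamma0 C0 rho_lt x_pinfty D D0.
pose B n := const_c R * n%:R `^ (1 - gamma) * C n * (2 + D n) ^+ 2.
have B_gt0 n : (2 <= n)%N -> 0 < B n.
  move=> n2; have n0 : 0 < n%:R :> R by rewrite ltr0n; lia.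
  have D2 : 0 < 2 + D n by have := D0 n; lra.
  by rewrite /B /const_c !mulr_gt0 ?exprn_gt0 ?powR_gt0.
exists (fun n => @best_system R n (C n) (D n) (B n)); split.
  by move=> n pos dest; exact: best_system_valid.
move=> dO Omega P pos dst SD W W0 cfg Esucc Ethr.
have goodthr n (p : 'I_n -> pt2 R) k sys : (2 <= n)%N -> good_system (C n) (D n) (B n) p k sys ->
    W / B n <= throughput W sys.
  move=> n2 [sysP _ pB]; rewrite /throughput ler_pM2l // lef_pV2 ?posrE ?B_gt0 //.
  by rewrite ltr0n; apply: period_gt0 sysP; lia.
have mE n : (2 <= n)%N -> measurable (Esucc n) /\ measurable (Ethr n).
  move=> n2; have [mpos [mdst _]] := SD n n2; split.
    apply: (measurable_best_system (Q := DC_successful (C n) (D n))) => //.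
      by move=> p k sys [].
    by move=> sys; apply: measurable_DC_successful.
  apply: (measurable_best_system (Q := fun _ sys => W / B n <= throughput W sys)) => //.
    by move=> p k sys; exact: goodthr.
  move=> sys; have [h|h] := boolP (W / B n <= throughput W sys).
    by rewrite (_ : mkset _ = setT) //; apply/seteqP; split.
  by rewrite (_ : mkset _ = set0) //; apply/seteqP; split.
split=> //.
pose x n := const_a R * n%:R * (C n / n%:R `^ gamma) ^+ 2 + ln (C n / n%:R `^ gamma).
(* A single event [G], the complement of the bad one, lies in both target events. *)
have low : \forall n \near \oo, exists2 G : set Omega, measurable G &
    [/\ G `<=` Esucc n, G `<=` Ethr n & ((1 - 425 * expR (- x n))%:E <= P G)%E].
  near=> n.
  have n2 : (2 <= n)%N by near: n; exists 2%N.
  have rhon : C n / n%:R `^ gamma < 2^-1 by near: n.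
  have xn : 0 <= x n by near: n; move/cvgryPge: x_pinfty; apply.
  have rad0 : 0 < n%:R `^ gamma :> R by rewrite powR_gt0 // ltr0n; lia.
  have rho0 : 0 < C n / n%:R `^ gamma by rewrite divr_gt0.
  have Crad : C n < n%:R `^ gamma / 2.
    by move: rhon; rewrite ltr_pdivrMr // mulrC.
  have [bad [mbad typ Pbad]] := atypical_bound n2 (SD n n2) (C0 n) Crad.
  exists (~` bad); first exact: measurableC.
  have good w : ~ bad w -> exists sys, good_system (C n) (D n) (B n) (pos n ^~ w) (dst n ^~ w) sys.
    move=> /typ[tw dN]; have n0 : (0 < n)%N by lia.
    have [sys [h1 h2 h3]] := typical_good_system (C0 n) Crad (D0 n) n0 dN tw.
    exists sys; split=> //; apply: le_trans h3 _.
    (* In terms of [rho = C n / n%:R]^ gamma[, the factor]n%:R [^ (1 - gamma) * C n] is [n * rho],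
       the parameter [q] of [typical]. *)
    have -> : B n = const_c R * (2 + D n) ^+ 2 * (n%:R * (C n / n%:R `^ gamma)).
      rewrite /B powRB; last by apply/implyP => _; rewrite pnatr_eq0; lia.
      by rewrite powRr1 //; field; rewrite gt_eqF.
    set q := n%:R * _; have q0 : 0 <= q by rewrite mulr_ge0 // ltW.
    have : 0 <= (2 + D n) ^+ 2 * q by rewrite mulr_ge0 ?sqr_ge0.
    (* The construction gives the constant [81 * 108 = 8748], well below [27 * 2 ^ 14]. *)
    by rewrite /const_c; lra.
  split.
  - by move=> w /good /best_system_good[].
  - by move=> w /good /best_system_good; apply: goodthr.
  - rewrite probability_setC // EFinB leeB //; apply: le_trans Pbad _.
    by rewrite lee_fin; apply: atypical_tail.
have lim1 : (fun n => (1 - 425 * expR (- x n))%:E) @ \oo --> 1%E.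
  apply: cvg_EFin; first by near=> n.
  rewrite [X in _ --> X](_ : _ = 1 - 425 * 0); last by rewrite mulr0 subr0.
  apply: cvgB; first exact: cvg_cst.
  apply: cvgM; first exact: cvg_cst.
  exact: (cvg_comp _ _ x_pinfty (@cvgr_expR R)).
(* Each probability is squeezed between [1 - 425 * expR (- x n)], which tends to 1, and 1. *)
have sq (E : nat -> set Omega) : (forall n, (2 <= n)%N -> measurable (E n)) ->
    (\forall n \near \oo, exists2 G : set Omega, measurable G &
       G `<=` E n /\ ((1 - 425 * expR (- x n))%:E <= P G)%E) ->
    (fun n => P (E n)) @ \oo --> 1%E.
  move=> mEn h; apply: (squeeze_cvge _ lim1 (cvg_cst 1%E)).
  near=> n.
  have n2 : (2 <= n)%N by near: n; exists 2%N.
  have [G mG [GE PG]] : exists2 G : set Omega, measurable G &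
       G `<=` E n /\ ((1 - 425 * expR (- x n))%:E <= P G)%E by near: n.
  apply/andP; split; last by apply: probability_le1; exact: mEn.
  apply: le_trans PG _.
  by apply: le_measure => //; rewrite inE //; apply: mEn.
split; apply: sq.
- by move=> n /mE[].
- by apply: filterS low => n [G mG [GE _ PG]]; exists G.
- by move=> n /mE[].
- by apply: filterS low => n [G mG [_ GE PG]]; exists G.
Unshelve. all: by end_near.
Qed.
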